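(* The system $\mathsf{ACA}_0^\omega+\mathsf{IND}$ proves that each of the following items implies $\mathsf{BOOT}$, i.e. the statement $(\forall Y^{2})(\exists X^{1})(\forall n^{0})\big[ n\in X \leftrightarrow (\exists f^{1})(Y(f, n)=0)\big]$: (a) a Heine-Borel compact complete metric space over $\mathbb{N}^{\mathbb{N}}$ is totally bounded; (b) a countable Heine-Borel compact complete metric space over $\mathbb{N}^{\mathbb{N}}$ is totally bounded; (c) a sequentially compact complete metric space over $\mathbb{N}^{\mathbb{N}}$ is totally bounded.
   Context: Finite types: $0$ is a type (natural numbers), and if $\sigma,\tau$ are types, so is $\sigma\to\tau$; $1\equiv 0\to 0$ and $n+1\equiv n\to 0$. Superscripts indicate types. Type $1$ objects are elements of $\mathbb{N}^{\mathbb{N}}$, type $2$ objects are functionals $\mathbb{N}^{\mathbb{N}}\to\mathbb{N}$. $\rho^{*}$ is the type of finite sequences of type $\rho$ objects, $|w|$ is the length of $w$; pairs and finite sequences are coded as usual. $\mathsf{L}_\omega$ is the language with variables of every finite type, constants $0,1,<_0,+_0,\times_0,=_0$, the combinators $\Pi,\Sigma$ and the recursor $\mathbf{R}_0$. For $\tau=(\tau_1\to\dots\to\tau_k\to 0)$, $x=_\tau y$ means $(\forall z_1^{\tau_1}\dots z_k^{\tau_k})(xz_1\dots z_k=_0 yz_1\dots z_k)$. The system $\mathsf{RCA}_0^\omega$ has the axioms: (a) $0,1,<_0,+_0,\times_0$ form an ordered semi-ring with equality $=_0$; (b) the defining axioms of the combinators $\Pi,\Sigma$ (giving $\lambda$-abstraction);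 (c) $\mathbf{R}_0(f^1,m^0,0)=m$ and $\mathbf{R}_0(f,m,n+1)=f(n,\mathbf{R}_0(f,m,n))$; (d) extensionality: $(\forall x^\rho,y^\rho,\varphi^{\rho\to\tau})(x=_\rho y\to\varphi(x)=_\tau\varphi(y))$ for all types $\rho,\tau$; (e) induction for quantifier-free formulas of $\mathsf{L}_\omega$; (f) $\mathsf{QF}\text{-}\mathsf{AC}^{1,0}$, where $\mathsf{QF}\text{-}\mathsf{AC}^{\sigma,\tau}$ is $(\forall x^\sigma)(\exists y^\tau)A(x,y)\to(\exists Y^{\sigma\to\tau})(\forall x^\sigma)A(x,Y(x))$ for quantifier-free $A$ of $\mathsf{L}_\omega$. $\mathsf{ACA}_0^\omega$ is $\mathsf{RCA}_0^\omega+(\mu^2)$, where $(\mu^2)$ is $(\exists\mu^2)(\forall f^1)\big[(\exists n)(f(n)=0)\to[f(\mu(f))=0\wedge(\forall i<\mu(f))f(i)\neq0]\wedge[(\forall n)(f(n)\neq 0)\to\mu(f)=0]\big]$. $\mathsf{IND}$ is the induction axiom for all formulas of $\mathsf{L}_\omega$. Sets are given by characteristic functions: $X\subseteq\mathbb{N}$ is a type $1$ object, $D\subseteq\mathbb{N}^{\mathbb{N}}$ is given by a type $2$ functional, and binary relations on $D$ are given by functionals of type $(1\times1)\to0$. Real numbers are represented by fast-converging Cauchy sequences of rationals $q_{(\cdot)}$, i.e. $|q_n-q_{n+i}|<2^{-n}$ for all $n,i$. A complete metric space $\tilde D$ over $\mathbb{N}^{\mathbb{N}}$ consists of $D\subseteq\mathbb{N}^{\mathbb{N}}$,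 an equivalence relation $=_D$ on $D$, and $d:D\times D\to\mathbb{R}$ such that for all $e,f,g\in D$: $d(e,f)=_{\mathbb{R}}0\leftrightarrow e=_Df$; $0\leq_{\mathbb{R}}d(e,f)=_{\mathbb{R}}d(f,e)$; $d(f,e)\leq_{\mathbb{R}}d(f,g)+d(g,e)$; and such that every Cauchy sequence in $D$ converges to some element of $D$ (with respect to $d$). Points of $\tilde D$ are elements of $D$; every mapping with domain $D$ is tacitly assumed to respect $=_D$. $B(e,r)=\{f\in D:d(f,e)<_{\mathbb{R}}r\}$. $\tilde D$ is Heine-Borel compact if for any $Y:D\to\mathbb{R}^+$, the cover $\bigcup_{e\in D}B(e,Y(e))$ has a finite sub-cover. $\tilde D$ is countable Heine-Borel compact if every countable cover of $D$, i.e. every cover $D\subset\bigcup_{n\in\mathbb{N}}B(d_n,r_n)$ given by a sequence $(d_n)_{n\in\mathbb{N}}$ in $D$ and a sequence of rationals $(r_n)_{n\in\mathbb{N}}$, has a finite sub-cover. $\tilde D$ is sequentially compact if every sequence in $D$ has a convergent sub-sequence. $\tilde D$ is totally bounded if there is a sequence $\lambda n.x_n^{0\to1^*}$ of finite sequences of points of $\tilde D$ such that for any $x\in D$ and any $n\in\mathbb{N}$, $d(x,x_n(i))<2^{-n}$ for some $i<|x_n|$. *)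

(* Defs.v *)
From Stdlib Require Import List.
Import ListNotations.

Set Implicit Arguments.
Unset Strict Implicit.
Unset Printing Implicit Defensive.

(** Terms and formulas of L_omega are intrinsically typed and well scoped: a
    context is the list of the types of the free variables (de Bruijn
    indices). *)

Inductive ty : Type := N | Arr (s t : ty).

Declare Scope ty_scope.
Delimit Scope ty_scope with ty.
Bind Scope ty_scope with ty.
Notation "s ⟶ t" := (Arr s t) (at level 60, right associativity) : ty_scope.

Definition ty1 : ty := N ⟶ N.
Definition ty2 : ty := ty1 ⟶ N.

Definition ctx : Type := list ty.

Inductive var : ctx -> ty -> Type :=
| vz (G : ctx) (s : ty) : var (s :: G) s
| vs (G : ctx) (s t : ty) : var G s -> var (t :: G) s.
Arguments vz {G s}.
Arguments vs {G s t} v.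

(** [Rec] is R_0 with its first argument, a binary function on numbers,
    curried. *)
Inductive term (G : ctx) : ty -> Type :=
| Var (s : ty) : var G s -> term G s
| App (s t : ty) : term G (s ⟶ t)%ty -> term G s -> term G t
| Zero : term G N
| One : term G N
| Plus : term G (N ⟶ N ⟶ N)%ty
| Times : term G (N ⟶ N ⟶ N)%ty
| Pi (s t : ty) : term G (s ⟶ t ⟶ s)%ty
| Sigma (r s t : ty) : term G ((r ⟶ s ⟶ t) ⟶ (r ⟶ s) ⟶ r ⟶ t)%ty
| Rec : term G ((N ⟶ N ⟶ N) ⟶ N ⟶ N ⟶ N)%ty.
Arguments Zero {G}.
Arguments One {G}.
Arguments Plus {G}.
Arguments Times {G}.
Arguments Pi {G} s t.
Arguments Sigma {G} r s t.
Arguments Rec {G}.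

Declare Scope term_scope.
Delimit Scope term_scope with term.
Bind Scope term_scope with term.

Inductive form : ctx -> Type :=
| Eq (G : ctx) : term G N -> term G N -> form G
| Lt (G : ctx) : term G N -> term G N -> form G
| Bot (G : ctx) : form G
| Imp (G : ctx) : form G -> form G -> form G
| And (G : ctx) : form G -> form G -> form G
| Or (G : ctx) : form G -> form G -> form G
| All (G : ctx) (s : ty) : form (s :: G) -> form G
| Ex (G : ctx) (s : ty) : form (s :: G) -> form G.
Arguments Bot {G}.

Declare Scope form_scope.
Delimit Scope form_scope with form.
Bind Scope form_scope with form.

Fixpoint qf {G : ctx} (p : form G) : Prop :=
  match p with
  | Eq _ _ | Lt _ _ | Bot => True
  | Imp p q | And p q | Or p q => qf p /\ qf q
  | All _ | Ex _ => False
  end.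

Definition ren (G D : ctx) : Type := forall s, var G s -> var D s.
Definition sub (G D : ctx) : Type := forall s, var G s -> term D s.

Definition var_case {G : ctx} {t : ty} (P : ty -> Type) (z : P t)
    (f : forall s, var G s -> P s) (s : ty) (v : var (t :: G) s) : P s :=
  match v in var G' s' return
    match G' with
    | [] => unit
    | t' :: G'' => P t' -> (forall s, var G'' s -> P s) -> P s'
    end
  with
  | vz => fun z _ => z
  | vs v' => fun _ f => f _ v'
  end z f.

Definition wk {G : ctx} {t : ty} : ren G (t :: G) := fun s v => vs v.

Definition ren_up {G D : ctx} {t : ty} (r : ren G D) : ren (t :: G) (t :: D) :=
  var_case (P := var (t :: D)) vz (fun s v => vs (r s v)).

Fixpoint ren_term {G D : ctx} (r : ren G D) {s : ty} (a : term G s) : term D s :=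
  match a with
  | Var v => Var (r _ v)
  | App f b => App (ren_term r f) (ren_term r b)
  | Zero => Zero
  | One => One
  | Plus => Plus
  | Times => Times
  | Pi s t => Pi s t
  | Sigma r s t => Sigma r s t
  | Rec => Rec
  end.

Fixpoint ren_form {G : ctx} (p : form G) : forall D, ren G D -> form D :=
  match p with
  | Eq a b => fun D r => Eq (ren_term r a) (ren_term r b)
  | Lt a b => fun D r => Lt (ren_term r a) (ren_term r b)
  | Bot => fun D r => Bot
  | Imp p q => fun D r => Imp (ren_form p r) (ren_form q r)
  | And p q => fun D r => And (ren_form p r) (ren_form q r)
  | Or p q => fun D r => Or (ren_form p r) (ren_form q r)
  | All p => fun D r => All (ren_form p (ren_up r))
  | Ex p => fun D r => Ex (ren_form p (ren_up r))
  end.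

Definition scons {G D : ctx} {t : ty} (a : term D t) (f : sub G D) :
    sub (t :: G) D :=
  var_case (P := term D) a f.

Definition sub_up {G D : ctx} {t : ty} (f : sub G D) : sub (t :: G) (t :: D) :=
  scons (Var vz) (fun s v => ren_term wk (f s v)).

Fixpoint sub_term {G D : ctx} (f : sub G D) {s : ty} (a : term G s) : term D s :=
  match a with
  | Var v => f _ v
  | App b c => App (sub_term f b) (sub_term f c)
  | Zero => Zero
  | One => One
  | Plus => Plus
  | Times => Times
  | Pi s t => Pi s t
  | Sigma r s t => Sigma r s t
  | Rec => Rec
  end.

Fixpoint sub_form {G : ctx} (p : form G) : forall D, sub G D -> form D :=
  match p with
  | Eq a b => fun D f => Eq (sub_term f a) (sub_term f b)
  | Lt a b => fun D f => Lt (sub_term f a) (sub_term f b)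
  | Bot => fun D f => Bot
  | Imp p q => fun D f => Imp (sub_form p f) (sub_form q f)
  | And p q => fun D f => And (sub_form p f) (sub_form q f)
  | Or p q => fun D f => Or (sub_form p f) (sub_form q f)
  | All p => fun D f => All (sub_form p (sub_up f))
  | Ex p => fun D f => Ex (sub_form p (sub_up f))
  end.

Definition inst {G : ctx} {t : ty} (p : form (t :: G)) (a : term G t) : form G :=
  sub_form p (scons a (fun s v => Var v)).

Definition theory : Type := forall G : ctx, form G -> Prop.

Inductive prv (T : theory) : forall G : ctx, list (form G) -> form G -> Prop :=
| prv_ax G (A : list (form G)) p : T G p -> prv T A p
| prv_hyp G (A : list (form G)) p : In p A -> prv T A p
| prv_lem G (A : list (form G)) p : prv T A (Or p (Imp p Bot))
| prv_botE G (A : list (form G)) p : prv T A Bot -> prv T A p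
| prv_impI G (A : list (form G)) p q : prv T (p :: A) q -> prv T A (Imp p q)
| prv_impE G (A : list (form G)) p q :
    prv T A (Imp p q) -> prv T A p -> prv T A q
| prv_andI G (A : list (form G)) p q :
    prv T A p -> prv T A q -> prv T A (And p q)
| prv_andE1 G (A : list (form G)) p q : prv T A (And p q) -> prv T A p
| prv_andE2 G (A : list (form G)) p q : prv T A (And p q) -> prv T A q
| prv_orI1 G (A : list (form G)) p q : prv T A p -> prv T A (Or p q)
| prv_orI2 G (A : list (form G)) p q : prv T A q -> prv T A (Or p q)
| prv_orE G (A : list (form G)) p q r :
    prv T A (Or p q) -> prv T (p :: A) r -> prv T (q :: A) r -> prv T A r
| prv_allI G (A : list (form G)) s (p : form (s :: G)) :
    prv T (map (fun q => ren_form q wk) A) p -> prv T A (All p)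
| prv_allE G (A : list (form G)) s (p : form (s :: G)) (a : term G s) :
    prv T A (All p) -> prv T A (inst p a)
| prv_exI G (A : list (form G)) s (p : form (s :: G)) (a : term G s) :
    prv T A (inst p a) -> prv T A (Ex p)
| prv_exE G (A : list (form G)) s (p : form (s :: G)) q :
    prv T A (Ex p) ->
    prv T (p :: map (fun q => ren_form q wk) A) (ren_form q wk) ->
    prv T A q.

Definition proves (T : theory) (p : form []) : Prop := prv T [] p.

(** [ALL x : s, p] and [EX x : s, p] name the variable bound by the quantifier;
    a term written outside a quantifier must be lifted, [↑a], to be used below
    it (through any number of quantifiers). *)

Class Lift (G D : ctx) : Type := lift_ren : ren G D.
#[export] Instance lift_here (G : ctx) : Lift G G := fun s v => v.
#[export] Instance lift_there (G D : ctx) (t : ty) (l : Lift G D) :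
  Lift G (t :: D) := fun s v => vs (lift_ren v).

Definition lift {G D : ctx} {l : Lift G D} {s : ty} (a : term G s) : term D s :=
  ren_term (lift_ren (Lift := l)) a.

Definition all_ {G : ctx} (s : ty) (p : term (s :: G) s -> form (s :: G)) : form G :=
  All (p (Var vz)).
Definition ex_ {G : ctx} (s : ty) (p : term (s :: G) s -> form (s :: G)) : form G :=
  Ex (p (Var vz)).

Notation "↑ a" := (lift a) (at level 9, a at level 9, format "↑ a").
Notation "f @ a" := (App f a) (at level 25, left associativity) : term_scope.
Notation "0" := Zero : term_scope.
Notation "1" := One : term_scope.
Notation "a + b" := (App (App Plus a) b) : term_scope.
Notation "a * b" := (App (App Times a) b) : term_scope.

Notation "a = b" := (Eq a b) : form_scope.
Notation "a < b" := (Lt a b) : form_scope.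
Notation "a <= b" := (Or (Lt a b) (Eq a b)) : form_scope.
Notation "p ==> q" := (Imp p q) (at level 96, right associativity) : form_scope.
Notation "p /\ q" := (And p q) : form_scope.
Notation "p \/ q" := (Or p q) : form_scope.
Notation "~ p" := (Imp p Bot) : form_scope.
Notation "p <-> q" := (And (Imp p q) (Imp q p)) : form_scope.
Notation "'ALL' x : s , p" := (all_ (s := s) (fun x => p))
  (at level 200, x name, s at level 60, p at level 200) : form_scope.
Notation "'EX' x : s , p" := (ex_ (s := s) (fun x => p))
  (at level 200, x name, s at level 60, p at level 200) : form_scope.

Arguments all_ {G s} p%_form.
Arguments ex_ {G s} p%_form.

Local Open Scope form_scope.

Fixpoint eqt {G : ctx} {s : ty} : term G s -> term G s -> form G :=
  match s with
  | N => fun a b => a = b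
  | (s ⟶ t)%ty => fun a b => ALL z : s, eqt (↑a @ z) (↑b @ z)
  end.

Definition equality_axioms (G : ctx) : list (form G) :=
  [ ALL x : N, x = x;
    ALL x : N, ALL y : N, ↑x = y ==> y = ↑x;
    ALL x : N, ALL y : N, ALL z : N, ↑x = ↑y ==> ↑y = z ==> ↑x = z;
    ALL x : N, ALL x' : N, ALL y : N, ALL y' : N,
      ↑x = ↑x' ==> ↑y = y' ==> ↑x < ↑y ==> ↑x' < y' ].

Definition ordered_semiring_axioms (G : ctx) : list (form G) :=
  [ ALL x : N, ALL y : N, ALL z : N, (↑x + ↑y) + z = ↑x + (↑y + z);
    ALL x : N, ALL y : N, ↑x + y = y + ↑x;
    ALL x : N, x + 0 = x;
    ALL x : N, ALL y : N, ALL z : N, (↑x * ↑y) * z = ↑x * (↑y * z);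
    ALL x : N, ALL y : N, ↑x * y = y * ↑x;
    ALL x : N, x * 1 = x;
    ALL x : N, x * 0 = 0;
    ALL x : N, ALL y : N, ALL z : N, ↑x * (↑y + z) = ↑x * ↑y + ↑x * z;
    ALL x : N, ~ (x < x);
    ALL x : N, ALL y : N, ALL z : N, ↑x < ↑y ==> ↑y < z ==> ↑x < z;
    ALL x : N, ALL y : N, ↑x < y \/ ↑x = y \/ y < ↑x;
    ALL x : N, ALL y : N, ALL z : N, ↑x < ↑y ==> ↑x + z < ↑y + z;
    ALL x : N, ALL y : N, ALL z : N, 0 < z ==> ↑x < ↑y ==> ↑x * z < ↑y * z;
    0 < 1;
    ALL x : N, 0 <= x ].

Definition Pi_axiom (G : ctx) (s t : ty) : form G :=
  ALL x : s, ALL y : t, eqt (Pi s t @ ↑x @ y) ↑x.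

Definition Sigma_axiom (G : ctx) (r s t : ty) : form G :=
  ALL x : (r ⟶ s ⟶ t), ALL y : (r ⟶ s), ALL z : r,
    eqt (Sigma r s t @ ↑x @ ↑y @ z) (↑x @ z @ (↑y @ z)).

Definition Rec_axiom (G : ctx) : form G :=
  ALL f : (N ⟶ N ⟶ N), ALL m : N,
    Rec @ ↑f @ m @ 0 = m
    /\ ALL n : N, Rec @ ↑f @ ↑m @ (n + 1) = ↑f @ n @ (Rec @ ↑f @ ↑m @ n).

Definition ext_axiom (G : ctx) (r t : ty) : form G :=
  ALL x : r, ALL y : r, ALL f : (r ⟶ t),
    eqt ↑x ↑y ==> eqt (f @ ↑x) (f @ ↑y).

Definition ind_axiom (G : ctx) (p : form (N :: G)) : form G :=
  inst p 0
  /\ All (p ==> sub_form p (scons (Var vz + 1) (fun s v => Var (vs v))))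
  ==> All p.

(** In A(x, y) = [p], x is the variable of index 1 and y that of index 0. *)
Definition ac_axiom (G : ctx) (s t : ty) (p : form (t :: s :: G)) : form G :=
  All (Ex p)
  ==> EX Y : (s ⟶ t), ALL x : s,
        sub_form p (scons (↑Y @ x) (scons x (fun r v => Var (vs (vs v))))).

Definition mu2 (G : ctx) : form G :=
  EX mu : ty2, ALL f : ty1,
    ((EX n : N, ↑f @ n = 0)
       ==> f @ (↑mu @ f) = 0 /\ ALL i : N, i < ↑mu @ ↑f ==> ~ (↑f @ i = 0))
    /\ ((ALL n : N, ~ (↑f @ n = 0)) ==> ↑mu @ f = 0).

Inductive RCA0w : theory :=
| RCA0w_equality G p : In p (equality_axioms G) -> RCA0w p
| RCA0w_semiring G p : In p (ordered_semiring_axioms G) -> RCA0w p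
| RCA0w_Pi G s t : RCA0w (Pi_axiom G s t)
| RCA0w_Sigma G r s t : RCA0w (Sigma_axiom G r s t)
| RCA0w_Rec G : RCA0w (Rec_axiom G)
| RCA0w_ext G r t : RCA0w (ext_axiom G r t)
| RCA0w_QFind G (p : form (N :: G)) : qf p -> RCA0w (ind_axiom p)
| RCA0w_QFAC10 G (p : form (N :: ty1 :: G)) : qf p -> RCA0w (ac_axiom p).

Inductive ACA0w : theory :=
| ACA0w_RCA0w G (p : form G) : RCA0w p -> ACA0w p
| ACA0w_mu2 G : ACA0w (mu2 G).

Inductive ACA0w_IND : theory :=
| ACA0w_IND_base G (p : form G) : ACA0w p -> ACA0w_IND p
| ACA0w_IND_scheme G (p : form (N :: G)) : ACA0w_IND (ind_axiom p).

Section Codes.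
Context {G : ctx}.

Local Notation term0 := (term G N).

(** Injective, but not surjective. *)
Definition pair_ (a b : term0) : term0 := ((a + b) * (a + b) + a)%term.

(** λn. 2^n, obtained as λn. R_0(λi j. j + j, 1, n), where
    λj. j + j is Σ(+)(ΣΠΠ). *)
Definition exp2 (n : term0) : term0 :=
  (Rec @ (Pi (N ⟶ N) N
          @ (Sigma N N N @ Plus @ (Sigma N (N ⟶ N) N @ Pi N (N ⟶ N) @ Pi N N)))
       @ 1 @ n)%term.

(** The type 1 object n, f(0), f(1), ..., obtained as λk. R_0(λi j. f(i), n, k),
    where λi j. f(i) is Σ(ΠΠ)f. *)
Definition seq_cons (n : term0) (f : term G ty1) : term G ty1 :=
  (Rec @ (Sigma N N (N ⟶ N) @ (Pi (N ⟶ N ⟶ N) N @ Pi N N) @ f) @ n)%term.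

(** [Frac a b c] stands for the rational number (a - b) / c. *)
Record frac : Type := Frac { fpos : term0; fneg : term0; fden : term0 }.

Definition fadd (p q : frac) : frac :=
  Frac (fpos p * fden q + fpos q * fden p)
       (fneg p * fden q + fneg q * fden p)
       (fden p * fden q).

Definition flt (p q : frac) : form G :=
  fpos p * fden q + fneg q * fden p < fpos q * fden p + fneg p * fden q.

Definition fle (p q : frac) : form G :=
  fpos p * fden q + fneg q * fden p <= fpos q * fden p + fneg p * fden q.

(** |p - q| < e and |p - q| <= e *)
Definition fdist_lt (p q e : frac) : form G :=
  flt p (fadd q e) /\ flt q (fadd p e).
Definition fdist_le (p q e : frac) : form G :=
  fle p (fadd q e) /\ fle q (fadd p e).

(** 2^(-n) and 2^(-n+1) *)
Definition fpow (n : term0) : frac := Frac 1 0 (exp2 n).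
Definition fpow' (n : term0) : frac := Frac (1 + 1) 0 (exp2 n).

Definition code (p : frac) : term0 := pair_ (pair_ (fpos p) (fneg p)) (fden p).

End Codes.

Arguments frac : clear implicits.

Definition lift_frac {G D : ctx} {l : Lift G D} (p : frac G) : frac D :=
  Frac ↑(fpos p) ↑(fneg p) ↑(fden p).

Notation "⇑ p" := (lift_frac p) (at level 9, p at level 9, format "⇑ p").

(** The number [t] codes a rational number (a - b) / c satisfying [k]. *)
Definition decode {G : ctx} (t : term G N)
    (k : frac (N :: N :: N :: G) -> form (N :: N :: N :: G)) : form G :=
  EX a : N, EX b : N, EX c : N,
    ↑t = code (Frac ↑a ↑b c) /\ 0 < c /\ k (Frac ↑a ↑b c).

Definition is_rat {G : ctx} (t : term G N) : form G :=
  decode t (fun _ => 0 = 0).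

Definition is_real {G : ctx} (x : term G ty1) : form G :=
  ALL n : N, ALL i : N,
    decode (↑x @ ↑n) (fun p => decode (↑x @ (↑n + ↑i)) (fun q =>
      fdist_lt ⇑p q (fpow ↑n))).

(** Since q_n is within 2^(-n) of the real number represented by q, comparing
    two real numbers at stage n involves an error of at most 2^(-n+1). *)
Definition real_eq {G : ctx} (x y : term G ty1) : form G :=
  ALL n : N,
    decode (↑x @ n) (fun p => decode (↑y @ ↑n) (fun q =>
      fdist_le ⇑p q (fpow' ↑n))).

Definition real_le {G : ctx} (x y : term G ty1) : form G :=
  ALL n : N,
    decode (↑x @ n) (fun p => decode (↑y @ ↑n) (fun q =>
      fle ⇑p (fadd q (fpow' ↑n)))).

Definition real_lt {G : ctx} (x y : term G ty1) : form G :=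
  EX n : N,
    decode (↑x @ n) (fun p => decode (↑y @ ↑n) (fun q =>
      flt (fadd ⇑p (fpow' ↑n)) q)).

(** x <= y + z, where y + z is represented by n ↦ y(n + 1) + z(n + 1). *)
Definition real_le_add {G : ctx} (x y z : term G ty1) : form G :=
  ALL n : N,
    decode (↑x @ n) (fun p => decode (↑y @ (↑n + 1)) (fun q =>
      decode (↑z @ (↑n + 1)) (fun r =>
        fle ⇑p (fadd (fadd ⇑q r) (fpow' ↑n))))).

(** The rational coded by [t], as a constant sequence. *)
Definition real_of_rat {G : ctx} (t : term G N) : term G ty1 := (Pi N N @ t)%term.

Definition real0 {G : ctx} : term G ty1 := real_of_rat (code (Frac 0 0 1)).

Definition real_pow {G : ctx} (n : term G N) : term G ty1 :=
  real_of_rat (code (fpow n)).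

(** Sets are 0/1-valued functionals, with value 1 at the members; functionals
    on pairs of type 1 objects are curried. *)
Definition is_set1 {G : ctx} (X : term G ty1) : form G :=
  ALL n : N, ↑X @ n = 0 \/ ↑X @ n = 1.
Definition is_set2 {G : ctx} (D : term G ty2) : form G :=
  ALL f : ty1, ↑D @ f = 0 \/ ↑D @ f = 1.
Definition is_rel {G : ctx} (E : term G (ty1 ⟶ ty1 ⟶ N)) : form G :=
  ALL f : ty1, ALL g : ty1, ↑E @ ↑f @ g = 0 \/ ↑E @ ↑f @ g = 1.

Definition mem {G : ctx} {s : ty} (x : term G s) (D : term G (s ⟶ N)) : form G :=
  D @ x = 1.

Section Metric.
Context {G : ctx}.
Variables (D : term G ty2) (E : term G (ty1 ⟶ ty1 ⟶ N))
          (d : term G (ty1 ⟶ ty1 ⟶ ty1)).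

Definition equivalence : form G :=
  (ALL e : ty1, mem e ↑D ==> ↑E @ e @ e = 1)
  /\ (ALL e : ty1, ALL f : ty1, mem ↑e ↑D ==> mem f ↑D ==>
        ↑E @ ↑e @ f = 1 ==> ↑E @ f @ ↑e = 1)
  /\ (ALL e : ty1, ALL f : ty1, ALL g : ty1,
        mem ↑e ↑D ==> mem ↑f ↑D ==> mem g ↑D ==>
        ↑E @ ↑e @ ↑f = 1 ==> ↑E @ ↑f @ g = 1 ==> ↑E @ ↑e @ g = 1).

Definition metric : form G :=
  (ALL e : ty1, ALL f : ty1, mem ↑e ↑D ==> mem f ↑D ==> is_real (↑d @ ↑e @ f))
  /\ (ALL e : ty1, ALL e' : ty1, ALL f : ty1, ALL f' : ty1,
        mem ↑e ↑D ==> mem ↑e' ↑D ==> mem ↑f ↑D ==> mem f' ↑D ==>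
        ↑E @ ↑e @ ↑e' = 1 ==> ↑E @ ↑f @ f' = 1 ==>
        real_eq (↑d @ ↑e @ ↑f) (↑d @ ↑e' @ f'))
  /\ (ALL e : ty1, ALL f : ty1, mem ↑e ↑D ==> mem f ↑D ==>
        (real_eq (↑d @ ↑e @ f) real0 <-> ↑E @ ↑e @ f = 1))
  /\ (ALL e : ty1, ALL f : ty1, mem ↑e ↑D ==> mem f ↑D ==>
        real_le real0 (↑d @ ↑e @ f)
        /\ real_eq (↑d @ ↑e @ f) (↑d @ f @ ↑e))
  /\ (ALL e : ty1, ALL f : ty1, ALL g : ty1,
        mem ↑e ↑D ==> mem ↑f ↑D ==> mem g ↑D ==>
        real_le_add (↑d @ ↑f @ ↑e) (↑d @ ↑f @ g) (↑d @ g @ ↑e)).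

Definition seq_in (x : term G (N ⟶ ty1)) : form G :=
  ALL n : N, mem (↑x @ n) ↑D.

Definition cauchy (x : term G (N ⟶ ty1)) : form G :=
  ALL k : N, EX m : N, ALL i : N, ALL j : N,
    ↑m <= ↑i ==> ↑m <= j ==>
    real_lt (↑d @ (↑x @ ↑i) @ (↑x @ j)) (real_pow ↑k).

Definition converges_to (x : term G (N ⟶ ty1)) (y : term G ty1) : form G :=
  ALL k : N, EX m : N, ALL i : N,
    ↑m <= i ==> real_lt (↑d @ (↑x @ i) @ ↑y) (real_pow ↑k).

End Metric.

Section Spaces.
Context {G : ctx}.
Variables (D : term G ty2) (E : term G (ty1 ⟶ ty1 ⟶ N))
          (d : term G (ty1 ⟶ ty1 ⟶ ty1)).

Definition complete : form G :=
  ALL x : (N ⟶ ty1), seq_in ↑D x ==> cauchy ↑d x ==>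
    EX y : ty1, mem y ↑D /\ converges_to ↑d ↑x y.

Definition complete_metric_space : form G :=
  is_set2 D /\ is_rel E /\ equivalence D E /\ metric D E d /\ complete.

Definition heine_borel : form G :=
  ALL Y : (ty1 ⟶ ty1),
    (ALL e : ty1, mem e ↑D ==> is_real (↑Y @ e) /\ real_lt real0 (↑Y @ e)) ==>
    (ALL e : ty1, ALL f : ty1, mem ↑e ↑D ==> mem f ↑D ==>
       ↑E @ ↑e @ f = 1 ==> real_eq (↑Y @ ↑e) (↑Y @ f)) ==>
    EX k : N, EX e : (N ⟶ ty1),
      (ALL i : N, i < ↑k ==> mem (↑e @ i) ↑D)
      /\ ALL f : ty1, mem f ↑D ==>
           EX i : N, i < ↑k
             /\ real_lt (↑d @ ↑f @ (↑e @ i)) (↑Y @ (↑e @ i)).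

Definition countable_heine_borel : form G :=
  ALL x : (N ⟶ ty1), ALL r : ty1,
    seq_in ↑D ↑x ==>
    (ALL n : N, is_rat (↑r @ n)) ==>
    (ALL f : ty1, mem f ↑D ==>
       EX n : N, real_lt (↑d @ ↑f @ (↑x @ n)) (real_of_rat (↑r @ n))) ==>
    EX k : N, ALL f : ty1, mem f ↑D ==>
      EX n : N, n < ↑k
        /\ real_lt (↑d @ ↑f @ (↑x @ n)) (real_of_rat (↑r @ n)).

(** The sub-sequence λn. x(g(n)) is Σ(Πx)g. *)
Definition sequentially_compact : form G :=
  ALL x : (N ⟶ ty1), seq_in ↑D x ==>
    EX g : ty1,
      (ALL n : N, ↑g @ n < ↑g @ (n + 1))
      /\ EX y : ty1, mem y ↑D
           /\ converges_to ↑d (Sigma N N ty1 @ (Pi (N ⟶ ty1) N @ ↑x) @ ↑g) y.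

(** A sequence of finite sequences of type 1 objects is given by the sequence
    [l] of the lengths |x_n| together with the type 0→0→1 functional x; only the
    values x_n(i) with i < |x_n| matter. *)
Definition totally_bounded : form G :=
  EX l : ty1, EX x : (N ⟶ N ⟶ ty1),
    (ALL n : N, ALL i : N, i < ↑l @ ↑n ==> mem (↑x @ ↑n @ i) ↑D)
    /\ ALL f : ty1, mem f ↑D ==> ALL n : N,
         EX i : N, i < ↑l @ ↑n
           /\ real_lt (↑d @ ↑f @ (↑x @ ↑n @ i)) (real_pow ↑n).

End Spaces.

Definition item_a : form [] :=
  ALL D : ty2, ALL E : (ty1 ⟶ ty1 ⟶ N), ALL d : (ty1 ⟶ ty1 ⟶ ty1),
    complete_metric_space ↑D ↑E d ==> heine_borel ↑D ↑E d ==>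
    totally_bounded ↑D d.

Definition item_b : form [] :=
  ALL D : ty2, ALL E : (ty1 ⟶ ty1 ⟶ N), ALL d : (ty1 ⟶ ty1 ⟶ ty1),
    complete_metric_space ↑D ↑E d ==> countable_heine_borel ↑D d ==>
    totally_bounded ↑D d.

Definition item_c : form [] :=
  ALL D : ty2, ALL E : (ty1 ⟶ ty1 ⟶ N), ALL d : (ty1 ⟶ ty1 ⟶ ty1),
    complete_metric_space ↑D ↑E d ==> sequentially_compact ↑D d ==>
    totally_bounded ↑D d.

(** The pair (f, n) is coded by the type 1 object [seq_cons n f]. *)
Definition BOOT : form [] :=
  ALL Y : ty2, EX X : ty1,
    is_set1 X
    /\ ALL n : N, mem n ↑X <-> EX f : ty1, ↑Y @ seq_cons ↑n f = 0.

(* Main.v *)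
(** The calculus is complete: a sentence true in all extensional type structures
    (Henkin models of L_omega) satisfying the axioms is derivable. The
    implications may therefore be verified inside an arbitrary model, where only
    induction and comprehension have to be taken from the axioms.

    Given Y, let D consist of the points f with f(0) = 0 and of those with
    f(0) = n + 1 for which the tail g of f satisfies Y(g, n) = 0; points with the
    same f(0) are identified. With weights w(0) = 0 and w(a) = 2^(-a) for a > 0,
    put d(e, f) = w(e(0)) + w(f(0)) for different points. The space is a sequence
    of isolated points converging to the point of value 0, so completeness and the
    three compactness properties hold already by induction, without knowing which
    n + 1 are values. A finite 2^(-n-1)-net must however contain a point of value
    n + 1 if there is one, so total boundedness reduces the existence of f with
    Y(f, n) = 0 to a bounded search in the net. *)

From Stdlib Require Import Classical ClassicalEpsilon FunctionalExtensionality.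
From Stdlib Require Import PropExtensionality ProofIrrelevance Eqdep_dec.
From Stdlib Require Import List Arith Lia Cantor Ring.
Require Import Defs.
Import ListNotations.

Set Implicit Arguments.
Unset Strict Implicit.
Unset Printing Implicit Defensive.

(** * Substitution *)

(** The semantic route avoids long object-level derivations at the price of one completeness proof.
    Three features shape that proof. Models are extensional with respect to actual equality, so the
    term model is a quotient. Henkin witnesses are variables, so the context grows at every stage
    and all notions have to follow weakening. Axioms may have free variables, so the theory has to
    be closed under substitution. The numbers of a model may be nonstandard: an induction over them
    is legitimate only for a formula of L_omega, and a functional exists only if a term or
    quantifier-free choice provides it. Full [IND] serves formulas that quantify over points, such
    as the existence of a list representing all values below n; the functional mu turns an
    existential number quantifier into a set. Adding weights makes the triangle inequality
    immediate, since w(a) + w(b) is at most w(a) + 2w(c) + w(b), and keeps a point of value n + 1 at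
    distance at least 2^(-n-1) from every different one. *)

Lemma var_cons_ind (G : ctx) (t : ty) (P : forall s, var (t :: G) s -> Prop) :
  P t vz -> (forall s (v : var G s), P s (vs v)) -> forall s v, P s v.
Proof.
  intros Hz Hs s v; revert P Hz Hs.
  refine (match v as v' in var G' s' return
      match G' return var G' s' -> Prop with
      | [] => fun _ => True
      | t' :: G'' => fun v' => forall P : forall s, var (t' :: G'') s -> Prop,
          P t' vz -> (forall s (v : var G'' s), P s (vs v)) -> P s' v'
      end v' with vz => _ | vs v' => _ end); auto.
Qed.

(** Renamings, substitutions and environments are compared as functions, so that they can be
    rewritten inside [sub_form] and [sat]. *)
Lemma family_ext (G : ctx) (P : ty -> Type) (f g : forall s, var G s -> P s) :
  (forall s v, f s v = g s v) -> f = g.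
Proof.
  intros H; apply functional_extensionality_dep; intros s.
  apply functional_extensionality; apply H.
Qed.

Lemma sub_term_ren G D H (r : ren G D) (f : sub D H) s (a : term G s) :
  sub_term f (ren_term r a) = sub_term (fun s v => f s (r s v)) a.
Proof. induction a; cbn; congruence. Qed.

Lemma ren_term_sub G D H (f : sub G D) (r : ren D H) s (a : term G s) :
  ren_term r (sub_term f a) = sub_term (fun s v => ren_term r (f s v)) a.
Proof. induction a; cbn; congruence. Qed.

Lemma sub_term_sub G D H (f : sub G D) (g : sub D H) s (a : term G s) :
  sub_term g (sub_term f a) = sub_term (fun s v => sub_term g (f s v)) a.
Proof. induction a; cbn; congruence. Qed.

Lemma sub_term_id G s (a : term G s) : sub_term (fun s v => Var v) a = a.
Proof. induction a; cbn; congruence. Qed.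

Lemma ren_term_as_sub G D (r : ren G D) s (a : term G s) :
  ren_term r a = sub_term (fun s v => Var (r s v)) a.
Proof. induction a; cbn; congruence. Qed.

Lemma sub_up_wk G D (f : sub G D) t s (a : term G s) :
  sub_term (sub_up (t := t) f) (ren_term wk a) = ren_term wk (sub_term f a).
Proof. now rewrite sub_term_ren, ren_term_sub. Qed.

Lemma scons_wk G D (f : sub G D) t (b : term D t) s (a : term G s) :
  sub_term (scons b f) (ren_term wk a) = sub_term f a.
Proof. now rewrite sub_term_ren. Qed.

Lemma sub_up_sub G D H (f : sub G D) (g : sub D H) t :
  (fun s v => sub_term (sub_up g) (sub_up f v))
  = sub_up (t := t) (fun s v => sub_term g (f s v)).
Proof.
  apply family_ext; apply var_cons_ind; intros; cbn; [reflexivity|].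
  apply sub_up_wk.
Qed.

Lemma sub_up_var G t : sub_up (t := t) (fun s (v : var G s) => Var v) = fun s v => Var v.
Proof. apply family_ext; apply var_cons_ind; reflexivity. Qed.

Lemma sub_form_sub G (p : form G) : forall D H (f : sub G D) (g : sub D H),
  sub_form (sub_form p f) g = sub_form p (fun s v => sub_term g (f s v)).
Proof.
  induction p; intros; cbn; rewrite ?sub_term_sub, ?IHp1, ?IHp2, ?IHp, ?sub_up_sub;
    reflexivity.
Qed.

Lemma sub_form_id G (p : form G) : sub_form p (fun s v => Var v) = p.
Proof. induction p; cbn; rewrite ?sub_up_var, ?sub_term_id; congruence. Qed.

Lemma ren_form_as_sub G (p : form G) : forall D (r : ren G D),
  ren_form p r = sub_form p (fun s v => Var (r s v)).
Proof.
  assert (up : forall G D t (r : ren G D),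
    (fun s v => Var (ren_up (t := t) r v)) = sub_up (fun s v => Var (r s v))).
  { intros; apply family_ext; apply var_cons_ind; reflexivity. }
  induction p; intros; cbn; rewrite ?ren_term_as_sub, ?IHp1, ?IHp2, ?IHp, ?up;
    reflexivity.
Qed.

Lemma ren_form_sub G D H (p : form G) (f : sub G D) (r : ren D H) :
  ren_form (sub_form p f) r = sub_form p (fun s v => ren_term r (f s v)).
Proof.
  rewrite ren_form_as_sub, sub_form_sub; f_equal.
  apply family_ext; intros; now rewrite ren_term_as_sub.
Qed.

Lemma sub_inst G D (f : sub G D) t (p : form (t :: G)) (a : term G t) :
  sub_form (inst p a) f = sub_form p (scons (sub_term f a) f).
Proof.
  unfold inst; rewrite sub_form_sub; f_equal.
  apply family_ext; apply var_cons_ind; reflexivity.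
Qed.

Lemma inst_sub_up G D (f : sub G D) t (p : form (t :: G)) (a : term D t) :
  inst (sub_form p (sub_up f)) a = sub_form p (scons a f).
Proof.
  unfold inst; rewrite sub_form_sub; f_equal.
  apply family_ext; apply var_cons_ind; intros; cbn; [reflexivity|].
  now rewrite scons_wk, sub_term_id.
Qed.

(** Needed when the bound variable itself serves as the witness of a weakened existential
    formula. *)
Lemma inst_ren_up_wk G t (p : form (t :: G)) :
  inst (ren_form p (ren_up wk)) (Var vz) = p.
Proof.
  unfold inst; rewrite ren_form_as_sub, sub_form_sub.
  rewrite <- (sub_form_id p) at 2; f_equal.
  apply family_ext; apply var_cons_ind; reflexivity.
Qed.

Lemma sub_eqt s : forall G D (f : sub G D) (a b : term G s),
  sub_form (eqt a b) f = eqt (sub_term f a) (sub_term f b).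
Proof.
  induction s as [|s _ t IH]; intros; cbn; [reflexivity|].
  unfold all_; cbn; rewrite IH; cbn.
  now rewrite !(sub_up_wk f s).
Qed.

Lemma ren_eqt s G D (r : ren G D) (a b : term G s) :
  ren_form (eqt a b) r = eqt (ren_term r a) (ren_term r b).
Proof. now rewrite ren_form_as_sub, sub_eqt, !ren_term_as_sub. Qed.

Lemma qf_sub G (p : form G) : forall D (f : sub G D), qf p -> qf (sub_form p f).
Proof. induction p; cbn; intros; intuition. Qed.

(** The calculus never substitutes into an axiom. This closure makes open axioms true in the term
    model under every assignment. *)
Definition sub_closed (T : theory) : Prop :=
  forall G D (f : sub G D) p, T G p -> T D (sub_form p f).


Lemma sub_ind_axiom G D (f : sub G D) (p : form (N :: G)) :
  sub_form (ind_axiom p) f = ind_axiom (sub_form p (sub_up f)).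
Proof.
  unfold ind_axiom; cbn; rewrite sub_inst, inst_sub_up, !sub_form_sub; cbn.
  do 5 f_equal; apply family_ext; apply var_cons_ind; intros; cbn; [reflexivity|].
  now rewrite scons_wk, ren_term_as_sub.
Qed.

Lemma sub_ac_axiom G D (f : sub G D) s t (p : form (t :: s :: G)) :
  sub_form (ac_axiom p) f = ac_axiom (sub_form p (sub_up (sub_up f))).
Proof.
  unfold ac_axiom, ex_, all_; cbn; rewrite !sub_form_sub; cbn.
  do 4 f_equal; apply family_ext; apply var_cons_ind; [reflexivity|].
  apply var_cons_ind; [reflexivity|]; intros; cbn.
  rewrite scons_wk, sub_term_ren, !ren_term_as_sub, sub_term_sub; reflexivity.
Qed.

Lemma RCA0w_sub_closed : sub_closed RCA0w.
Proof.
  intros G D f p H; revert D f.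
  destruct H as [G p H|G p H|G s t|G r s t|G|G r t|G p H|G p H]; intros D f.
  - apply RCA0w_equality.
    cbn in H; decompose [or] H; try contradiction; subst; cbn; auto 6.
  - apply RCA0w_semiring.
    cbn in H; decompose [or] H; try contradiction; subst; cbn; auto 20.
  - replace (sub_form _ f) with (Pi_axiom D s t); [apply RCA0w_Pi|].
    cbn; unfold all_. now rewrite sub_eqt.
  - replace (sub_form _ f) with (Sigma_axiom D r s t); [apply RCA0w_Sigma|].
    cbn; unfold all_. now rewrite sub_eqt.
  - exact (RCA0w_Rec D).
  - replace (sub_form _ f) with (ext_axiom D r t); [apply RCA0w_ext|].
    cbn; unfold all_; cbn; now rewrite !sub_eqt.
  - rewrite sub_ind_axiom; apply RCA0w_QFind; now apply qf_sub.
  - rewrite sub_ac_axiom; apply RCA0w_QFAC10; now apply qf_sub.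
Qed.

Lemma ACA0w_IND_sub_closed : sub_closed ACA0w_IND.
Proof.
  intros G D f p H; revert D f; destruct H as [G p H|G p]; intros D f.
  - apply ACA0w_IND_base; revert D f; destruct H as [G p H|G]; intros D f.
    + now apply ACA0w_RCA0w, RCA0w_sub_closed.
    + exact (ACA0w_mu2 D).
  - rewrite sub_ind_axiom; apply ACA0w_IND_scheme.
Qed.

(** * Enumeration of formulas *)

Definition ty_eq_dec (s t : ty) : {s = t} + {s <> t}.
Proof. decide equality. Defined.

Lemma ty_eq_dec_refl s : ty_eq_dec s s = left eq_refl.
Proof.
  destruct (ty_eq_dec s s) as [e|n]; [|easy].
  f_equal; apply UIP_dec, ty_eq_dec.
Qed.

(** The argument [k] is fuel, because decoding is not structurally recursive in the code [n]. *)
Fixpoint nth_ty (k n : nat) : ty :=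
  match k with
  | O => N
  | S k =>
      let (i, r) := Cantor.of_nat n in
      match i with
      | O => N
      | _ => let (a, b) := Cantor.of_nat r in Arr (nth_ty k a) (nth_ty k b)
      end
  end.

Fixpoint nth_var (G : ctx) (n : nat) : option {s & var G s} :=
  match G, n with
  | [], _ => None
  | s :: G, O => Some (existT _ s vz)
  | s :: G, S n =>
      match nth_var G n with
      | Some (existT _ t v) => Some (existT _ t (vs v))
      | None => None
      end
  end.

Definition some_app G (a b : {s & term G s}) : option {s & term G s} :=
  let (s, a) := a in
  let (r, b) := b in
  match s as s return term G s -> option {s & term G s} with
  | N => fun _ => None
  | Arr r' t => fun a =>
      match ty_eq_dec r r' with
      | left e => Some (existT _ t (App a (eq_rect r (term G) b r' e)))
      | right _ => None
      end
  end a.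

Definition bind {A B : Type} (x : option A) (f : A -> option B) : option B :=
  match x with Some a => f a | None => None end.

Fixpoint nth_term (G : ctx) (k n : nat) : option {s & term G s} :=
  match k with
  | O => None
  | S k =>
      let (i, r) := Cantor.of_nat n in
      let (a, r') := Cantor.of_nat r in
      let (b, c) := Cantor.of_nat r' in
      match i with
      | 0 => bind (nth_var G a) (fun v => Some (existT _ _ (Var (projT2 v))))
      | 1 => bind (nth_term G k a) (fun x => bind (nth_term G k b) (some_app x))
      | 2 => Some (existT _ _ Zero)
      | 3 => Some (existT _ _ One)
      | 4 => Some (existT _ _ Plus)
      | 5 => Some (existT _ _ Times)
      | 6 => Some (existT _ _ (Pi (nth_ty k a) (nth_ty k b)))
      | 7 => Some (existT _ _ (Sigma (nth_ty k a) (nth_ty k b) (nth_ty k c)))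
      | _ => Some (existT _ _ Rec)
      end
  end.

Definition nth_term_N (G : ctx) (k n : nat) : option (term G N) :=
  bind (nth_term G k n) (fun x : {s & term G s} =>
    let (s, a) := x in
    match s as s return term G s -> option (term G N) with
    | N => fun a => Some a
    | _ => fun _ => None
    end a).

Fixpoint nth_form (k : nat) (G : ctx) (n : nat) : option (form G) :=
  match k with
  | O => None
  | S k =>
      let (i, r) := Cantor.of_nat n in
      let (a, b) := Cantor.of_nat r in
      match i with
      | 0 => bind (nth_term_N G k a) (fun x => bind (nth_term_N G k b) (fun y =>
               Some (Eq x y)))
      | 1 => bind (nth_term_N G k a) (fun x => bind (nth_term_N G k b) (fun y =>
               Some (Lt x y)))
      | 2 => Some Bot
      | 3 => bind (nth_form k G a) (fun p => bind (nth_form k G b) (fun q =>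
               Some (Imp p q)))
      | 4 => bind (nth_form k G a) (fun p => bind (nth_form k G b) (fun q =>
               Some (And p q)))
      | 5 => bind (nth_form k G a) (fun p => bind (nth_form k G b) (fun q =>
               Some (Or p q)))
      | 6 => bind (nth_form k (nth_ty k a :: G) b) (fun p => Some (All p))
      | _ => bind (nth_form k (nth_ty k a :: G) b) (fun p => Some (Ex p))
      end
  end.

(** Stability under additional fuel allows the fuels of several components to be replaced by their
    sum. *)
Definition reached {A : Type} (e : nat -> nat -> A) (x : A) : Prop :=
  exists k n, forall k', k <= k' -> e k' n = x.

Ltac fuel k0 i a :=
  let k' := fresh "k" in
  exists (S k0), (Cantor.to_nat (i, a)); intros [|k'] ?; [lia|];
  cbn -[Cantor.of_nat Cantor.to_nat];
  repeat (rewrite Cantor.cancel_of_to; cbn -[Cantor.of_nat Cantor.to_nat]).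

Lemma nth_ty_reached t : reached nth_ty t.
Proof.
  induction t as [|s [k [n H]] t [k' [n' H']]].
  - exists 0, 0; now intros [|k].
  - fuel (k + k') 1 (Cantor.to_nat (n, n')); now rewrite H, H' by lia.
Qed.

Lemma nth_var_surj G s (v : var G s) : exists n, nth_var G n = Some (existT _ s v).
Proof.
  induction v as [G s|G s t v [n H]]; [now exists 0|].
  exists (S n); cbn; now rewrite H.
Qed.

Lemma nth_term_reached G s (a : term G s) :
  reached (nth_term G) (Some (existT _ s a)).
Proof.
  induction a as [s v|s t a [k [n H]] b [k' [n' H']]| | | | |s t|r s t|].
  - destruct (nth_var_surj v) as [n H].
    fuel 0 0 (Cantor.to_nat (n, Cantor.to_nat (0, 0))); now rewrite H.
  - fuel (k + k') 1 (Cantor.to_nat (n, Cantor.to_nat (n', 0))).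
    rewrite H, H' by lia; cbn; now rewrite ty_eq_dec_refl.
  - now fuel 0 2 (Cantor.to_nat (0, Cantor.to_nat (0, 0))).
  - now fuel 0 3 (Cantor.to_nat (0, Cantor.to_nat (0, 0))).
  - now fuel 0 4 (Cantor.to_nat (0, Cantor.to_nat (0, 0))).
  - now fuel 0 5 (Cantor.to_nat (0, Cantor.to_nat (0, 0))).
  - destruct (nth_ty_reached s) as [k [n H]], (nth_ty_reached t) as [k' [n' H']].
    fuel (k + k') 6 (Cantor.to_nat (n, Cantor.to_nat (n', 0))).
    now rewrite H, H' by lia.
  - destruct (nth_ty_reached r) as [k [n H]], (nth_ty_reached s) as [k' [n' H']],
      (nth_ty_reached t) as [k'' [n'' H'']].
    fuel (k + k' + k'') 7 (Cantor.to_nat (n, Cantor.to_nat (n', n''))).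
    now rewrite H, H', H'' by lia.
  - now fuel 0 8 (Cantor.to_nat (0, Cantor.to_nat (0, 0))).
Qed.

Lemma nth_term_N_reached G (a : term G N) : reached (nth_term_N G) (Some a).
Proof.
  destruct (nth_term_reached a) as [k [n H]]; exists k, n; intros k' le.
  unfold nth_term_N; now rewrite H.
Qed.

Lemma nth_form_reached G (p : form G) : reached (fun k => nth_form k G) (Some p).
Proof.
  induction p as [G a b|G a b|G|G p [k [n H]] q [k' [n' H']]
    |G p [k [n H]] q [k' [n' H']]|G p [k [n H]] q [k' [n' H']]
    |G s p [k [n H]]|G s p [k [n H]]].
  - destruct (nth_term_N_reached a) as [k [n H]], (nth_term_N_reached b) as [k' [n' H']].
    fuel (k + k') 0 (Cantor.to_nat (n, n')); now rewrite H, H' by lia.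
  - destruct (nth_term_N_reached a) as [k [n H]], (nth_term_N_reached b) as [k' [n' H']].
    fuel (k + k') 1 (Cantor.to_nat (n, n')); now rewrite H, H' by lia.
  - now fuel 0 2 (Cantor.to_nat (0, 0)).
  - fuel (k + k') 3 (Cantor.to_nat (n, n')); now rewrite H, H' by lia.
  - fuel (k + k') 4 (Cantor.to_nat (n, n')); now rewrite H, H' by lia.
  - fuel (k + k') 5 (Cantor.to_nat (n, n')); now rewrite H, H' by lia.
  - destruct (nth_ty_reached s) as [k' [n' H']].
    fuel (k + k') 6 (Cantor.to_nat (n', n)); rewrite H' by lia; now rewrite H by lia.
  - destruct (nth_ty_reached s) as [k' [n' H']].
    fuel (k + k') 7 (Cantor.to_nat (n', n)); rewrite H' by lia; now rewrite H by lia.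
Qed.

(** A code contains its own fuel; numbers that decode to nothing give the harmless [Bot]. *)
Definition enum (G : ctx) (n : nat) : form G :=
  let (k, m) := Cantor.of_nat n in
  match nth_form k G m with Some p => p | None => Bot end.

Lemma enum_surj G (p : form G) : exists n, enum G n = p.
Proof.
  destruct (nth_form_reached p) as [k [m H]]; exists (Cantor.to_nat (k, m)).
  unfold enum; now rewrite Cantor.cancel_of_to, H.
Qed.

(** * Models *)

(** Equality at type [N] is interpreted by actual equality, and [ap_ext] extends this to the defined
    equality at all higher types. *)
Record model : Type := Model {
  car : ty -> Type;
  ap : forall s t, car (s ⟶ t)%ty -> car s -> car t;
  m0 : car N;
  m1 : car N;
  mplus : car (N ⟶ N ⟶ N)%ty;
  mtimes : car (N ⟶ N ⟶ N)%ty;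
  mPi : forall s t, car (s ⟶ t ⟶ s)%ty;
  mSigma : forall r s t, car ((r ⟶ s ⟶ t) ⟶ (r ⟶ s) ⟶ r ⟶ t)%ty;
  mRec : car ((N ⟶ N ⟶ N) ⟶ N ⟶ N ⟶ N)%ty;
  mlt : car N -> car N -> Prop;
  ap_ext : forall s t (f g : car (s ⟶ t)%ty), (forall x, ap f x = ap g x) -> f = g
}.
Arguments mPi : clear implicits.
Arguments mSigma : clear implicits.
Arguments mRec : clear implicits.
Arguments m0 {m}.
Arguments m1 {m}.
Arguments mplus {m}.
Arguments mtimes {m}.

Definition env (M : model) (G : ctx) : Type := forall s, var G s -> car M s.

Definition nil_env (M : model) : env M [] := fun s v =>
  match v in var G s return match G with [] => car M s | _ => unit end with
  | vz => tt
  | vs _ => tt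
  end.

Definition econs (M : model) (G : ctx) (t : ty) (x : car M t) (e : env M G) :
    env M (t :: G) :=
  var_case (P := car M) x e.

Fixpoint eval (M : model) (G : ctx) (s : ty) (a : term G s) (e : env M G) : car M s :=
  match a with
  | Var v => e _ v
  | App f b => ap (eval f e) (eval b e)
  | Zero => m0
  | One => m1
  | Plus => mplus
  | Times => mtimes
  | Pi s t => mPi M s t
  | Sigma r s t => mSigma M r s t
  | Rec => mRec M
  end.

Fixpoint sat (M : model) (G : ctx) (p : form G) : env M G -> Prop :=
  match p with
  | Eq a b => fun e => eval a e = eval b e
  | Lt a b => fun e => mlt (eval a e) (eval b e)
  | Bot => fun _ => False
  | Imp p q => fun e => sat p e -> sat q e
  | And p q => fun e => sat p e /\ sat q e
  | Or p q => fun e => sat p e \/ sat q e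
  | All p => fun e => forall x, sat p (econs x e)
  | Ex p => fun e => exists x, sat p (econs x e)
  end.

Lemma eval_ren M G D (r : ren G D) (e : env M D) s (a : term G s) :
  eval (ren_term r a) e = eval a (fun s v => e s (r s v)).
Proof. induction a; cbn; congruence. Qed.

Lemma eval_sub M G D (f : sub G D) (e : env M D) s (a : term G s) :
  eval (sub_term f a) e = eval a (fun s v => eval (f s v) e).
Proof. induction a; cbn; congruence. Qed.

Lemma sat_sub M G (p : form G) : forall D (f : sub G D) (e : env M D),
  sat (sub_form p f) e <-> sat p (fun s v => eval (f s v) e).
Proof.
  assert (up : forall G D t (f : sub G D) (e : env M D) (x : car M t),
    (fun s v => eval (sub_up f v) (econs x e)) = econs x (fun s v => eval (f s v) e)).
  { intros; apply family_ext; apply var_cons_ind; intros; [reflexivity|].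
    exact (eval_ren _ _ _). }
  induction p; intros D f e; cbn;
    rewrite ?eval_sub, ?IHp1, ?IHp2; try reflexivity.
  - split; intros H x; specialize (H x); apply IHp in H || apply IHp;
      now rewrite up in *.
  - split; intros [x H]; exists x; apply IHp in H || apply IHp;
      now rewrite up in *.
Qed.

Lemma sat_eqt M s : forall G (a b : term G s) (e : env M G),
  sat (eqt a b) e <-> eval a e = eval b e.
Proof.
  induction s as [|s _ t IH]; intros; cbn; [reflexivity|].
  unfold lift; split.
  - intros H; apply ap_ext; intros x; specialize (H x).
    rewrite IH in H; cbn in H; now rewrite !eval_ren in H.
  - intros H x; rewrite IH; cbn; rewrite !eval_ren.
    apply (f_equal (fun f => ap f x)) in H; exact H.
Qed.

(** * Completeness *)

Definition axioms_in (T : theory) (L : forall G, list (form G)) : Prop :=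
  forall G p, In p (L G) -> T G p.

(** * Derived rules of the calculus *)

Section Derivations.
Context (T : theory) (Teq : axioms_in T equality_axioms)
  (Text : forall G r t, T G (ext_axiom G r t)).

Lemma prv_cut G (A : list (form G)) p q :
  prv T A p -> prv T (p :: A) q -> prv T A q.
Proof. intros H H'; eapply prv_impE; [|exact H]; now apply prv_impI. Qed.

(** The identity substitution brings an axiom into the form that [prv_allE_sub] consumes; its
    quantifiers are then removed one at a time while the substitution accumulates the terms. *)
Lemma prv_ax_id G (A : list (form G)) (p : form G) : T p -> prv T A (sub_form p (fun s v => Var v)).
Proof. intros H; rewrite sub_form_id; now apply prv_ax. Qed.

Lemma prv_allE_sub G D (A : list (form D)) s (p : form (s :: G)) (f : sub G D) a :
  prv T A (sub_form (All p) f) -> prv T A (sub_form p (scons a f)).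
Proof. intros H; rewrite <- inst_sub_up; now apply prv_allE. Qed.

Lemma eqt_refl s : forall G (A : list (form G)) (a : term G s), prv T A (eqt a a).
Proof.
  induction s as [|s _ t IH]; intros; cbn; [|apply prv_allI, IH].
  refine (prv_allE_sub (p := Eq (Var vz) (Var vz)) a (prv_ax_id A _)).
  apply Teq; cbn; auto.
Qed.

Lemma inst_eqt_app G s t (a b : term G (s ⟶ t)%ty) (c : term G s) :
  inst (eqt (App ↑a (Var vz)) (App ↑b (Var vz))) c = eqt (App a c) (App b c).
Proof.
  unfold inst; rewrite sub_eqt; cbn; unfold lift.
  now rewrite !(sub_term_ren (G := G)), !sub_term_id.
Qed.

Lemma eqt_app G (A : list (form G)) s t (a b : term G (s ⟶ t)%ty) (c : term G s) :
  prv T A (eqt a b) -> prv T A (eqt (App a c) (App b c)).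
Proof. intros H; rewrite <- inst_eqt_app; now apply prv_allE. Qed.

Lemma eqt_hyp_wk G (A : list (form G)) s t (a b : term G (s ⟶ t)%ty) :
  In (eqt a b) A ->
  prv T (map (fun q => ren_form q wk) A)
    (eqt (App ↑a (Var (vz (s := s)))) (App ↑b (Var vz))).
Proof.
  intros H; apply eqt_app; unfold lift; rewrite <- ren_eqt.
  apply prv_hyp; now apply (in_map (fun q => ren_form q wk)).
Qed.

Lemma eqt_sym s : forall G (A : list (form G)) (a b : term G s),
  prv T A (Imp (eqt a b) (eqt b a)).
Proof.
  induction s as [|s _ t IH]; intros G A a b.
  - refine (prv_allE_sub (p := Imp (Eq (Var (vs vz)) (Var vz)) (Eq (Var vz) (Var (vs vz))))
      b (prv_allE_sub a (prv_ax_id A _))).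
    apply Teq; cbn; auto.
  - apply prv_impI, prv_allI; eapply prv_impE; [apply IH|].
    apply (eqt_hyp_wk (A := _ :: A)); now left.
Qed.

Lemma eqt_trans s : forall G (A : list (form G)) (a b c : term G s),
  prv T A (Imp (eqt a b) (Imp (eqt b c) (eqt a c))).
Proof.
  induction s as [|s _ t IH]; intros G A a b c.
  - refine (prv_allE_sub (p := Imp (Eq (Var (vs (vs vz))) (Var (vs vz)))
      (Imp (Eq (Var (vs vz)) (Var vz)) (Eq (Var (vs (vs vz))) (Var vz))))
      c (prv_allE_sub b (prv_allE_sub a (prv_ax_id A _)))).
    apply Teq; cbn; auto.
  - apply prv_impI, prv_impI, prv_allI.
    eapply prv_impE; [eapply prv_impE; [apply IH|]|];
      apply (eqt_hyp_wk (A := _ :: _ :: A)); cbn; auto.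
Qed.

(** Changing the function is pointwise equality at [a]; changing the argument of [g] is the
    extensionality axiom. Transitivity joins the two. *)
Lemma eqt_cong s t G (A : list (form G)) (f g : term G (s ⟶ t)%ty) (a b : term G s) :
  prv T A (Imp (eqt f g) (Imp (eqt a b) (eqt (App f a) (App g b)))).
Proof.
  apply prv_impI, prv_impI.
  eapply prv_impE; [eapply prv_impE; [apply eqt_trans|]|].
  - apply eqt_app, prv_hyp; cbn; auto.
  - pose proof (prv_allE_sub g (prv_allE_sub b (prv_allE_sub a
      (prv_ax_id (eqt a b :: eqt f g :: A) (Text G s t))))) as H.
    cbn in H; rewrite !sub_eqt in H.
    eapply prv_impE; [exact H|apply prv_hyp; cbn; auto].
Qed.

Lemma Lt_cong G (A : list (form G)) (a a' b b' : term G N) :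
  prv T A (Imp (Eq a a') (Imp (Eq b b') (Imp (Lt a b) (Lt a' b')))).
Proof.
  refine (prv_allE_sub (p := Imp (Eq (Var (vs (vs (vs vz)))) (Var (vs (vs vz))))
    (Imp (Eq (Var (vs vz)) (Var vz))
      (Imp (Lt (Var (vs (vs (vs vz)))) (Var (vs vz))) (Lt (Var (vs (vs vz))) (Var vz)))))
    b' (prv_allE_sub b (prv_allE_sub a' (prv_allE_sub a (prv_ax_id A _))))).
  apply Teq; cbn; auto.
Qed.

Lemma not_ex_not_all G (A : list (form G)) s (p : form (s :: G)) :
  prv T A (Imp (Imp (Ex (Imp p Bot)) Bot) (All p)).
Proof.
  apply prv_impI, prv_allI; eapply prv_orE; [apply prv_lem|apply prv_hyp; now left|].
  apply prv_botE; eapply prv_impE; [apply prv_hyp; right; now left|].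
  apply prv_exI with (a := Var vz); apply prv_hyp; left.
  symmetry; apply (inst_ren_up_wk (Imp p Bot)).
Qed.

(** Every type has a closed inhabitant, built from zero and constant functions, and instantiating
    the extra variable with it removes that variable. *)
Lemma prv_wk_bot G (A : list (form G)) s :
  prv T (map (fun q => ren_form q wk) A) (Bot (G := s :: G)) ->
  prv T A Bot.
Proof.
  assert (a : term G s) by (clear; induction s; [exact Zero|exact (App (Pi s2 s1) IHs2)]).
  intros H; apply prv_allI in H; exact (prv_allE a H).
Qed.

Lemma prv_not G (A : list (form G)) p :
  prv T (p :: A) Bot -> prv T (Imp p Bot :: A) Bot -> prv T A Bot.
Proof.
  intros H H'; apply prv_impI in H, H'; exact (prv_impE H' H).
Qed.

End Derivations.

(** * The Henkin construction *)

Section Completeness.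
Context (T : theory) (Teq : axioms_in T equality_axioms)
  (Text : forall G r t, T G (ext_axiom G r t)) (Tsub : sub_closed T).

Definition consistent G (A : list (form G)) : Prop := ~ prv T A Bot.

(** The witness of an existential formula is the newest variable of the next context. Other formulas
    also add a variable, of type [N], so that every stage extends the context by exactly one. *)
Definition witness G (p : form G) : {s & list (form (s :: G))} :=
  match p in form G return {s & list (form (s :: G))} with
  | @Ex G s q => existT _ s [q]
  | _ => existT _ N []
  end.

Definition weaken G (A : list (form G)) s : list (form (s :: G)) :=
  map (fun q => ren_form q wk) A.

(** Existential elimination with conclusion [Bot] discards the witness hypothesis; in the remaining
    cases only an idle variable was added. *)
Lemma witness_consistent G (A : list (form G)) p : consistent (p :: A) ->
  consistent (projT2 (witness p) ++ weaken (p :: A) _).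
Proof.
  intros H H'; apply H; clear H.
  destruct p; try exact (prv_wk_bot H').
  exact (prv_exE (q := Bot) (prv_hyp T (in_eq (Ex p) A)) H').
Qed.

(** The formula is kept as a variable [q] with an equation because the type of the result depends on
    [witness q]. *)
Lemma witness_spec G s (p : form (s :: G)) q : q = Ex p ->
  exists a : term (projT1 (witness q) :: G) s,
    In (sub_form p (scons a (fun s v => Var (wk v)))) (projT2 (witness q)).
Proof.
  intros ->; exists (Var vz); left.
  transitivity (sub_form p (fun s v => Var v)); [symmetry; apply sub_form_id|f_equal].
  apply family_ext; apply var_cons_ind; reflexivity.
Qed.

(** [spending] keeps one enumeration for each context met so far, weakened to the
    current context, so that every formula is decided at some later stage. *)
Record stage : Type := Stage {
  scxt : ctx;
  shyps : list (form scxt);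
  spending : list (nat -> form scxt)
}.

(** The stage number codes a pair: the second component selects the context whose enumeration is
    used, the first a formula in it. *)
Definition candidate (n : nat) (c : stage) : form (scxt c) :=
  nth (snd (Cantor.of_nat n)) (spending c) (fun _ => Bot) (fst (Cantor.of_nat n)).

Definition decided (n : nat) (c : stage) : form (scxt c) :=
  if excluded_middle_informative (consistent (candidate n c :: shyps c))
  then candidate n c else Imp (candidate n c) Bot.

Definition extend (n : nat) (c : stage) : stage :=
  Stage (projT2 (witness (decided n c)) ++ weaken (decided n c :: shyps c) _)
    (map (fun e n => ren_form (e n) wk) (spending c) ++ [@enum _]).

Context (p0 : form []) (p0_unprovable : ~ prv T [] p0).

Fixpoint henkin (n : nat) : stage :=
  match n with
  | O => Stage [Imp p0 Bot] [@enum []]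
  | S n => extend n (henkin n)
  end.

Definition hctx n := scxt (henkin n).
Definition hyps n : list (form (hctx n)) := shyps (henkin n).
Definition hwk n : ren (hctx n) (hctx (S n)) := @wk _ _.
Arguments hwk n [s] v.

Lemma decided_consistent n c :
  consistent (shyps c) -> consistent (decided n c :: shyps c).
Proof.
  unfold decided; destruct excluded_middle_informative as [H|H]; [easy|].
  intros Hc H'; apply H; intros H''; exact (Hc (prv_not H'' H')).
Qed.

Lemma hyps_consistent n : consistent (hyps n).
Proof.
  induction n as [|n IH].
  - intros H; apply p0_unprovable.
    eapply prv_orE; [apply (prv_lem T [] p0)|apply prv_hyp; now left|].
    now apply prv_botE.
  - now apply witness_consistent, decided_consistent.
Qed.

Lemma hyps_S n p : In p (hyps n) -> In (ren_form p (hwk n)) (hyps (S n)).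
Proof.
  intros H; apply in_or_app; right; right.
  now apply (in_map (fun q => ren_form q wk)).
Qed.

Lemma decided_in n : In (ren_form (decided n (henkin n)) (hwk n)) (hyps (S n)).
Proof. apply in_or_app; right; now left. Qed.

Lemma witness_in n s (p : form (s :: hctx n)) : decided n (henkin n) = Ex p ->
  exists a : term (hctx (S n)) s,
    In (sub_form p (scons a (fun s v => Var (hwk n v)))) (hyps (S n)).
Proof.
  intros H; destruct (witness_spec H) as [a Ha]; exists a.
  apply in_or_app; now left.
Qed.

Definition eventually (P : nat -> Prop) : Prop := exists n, forall m, n <= m -> P m.

Lemma eventually_mono (P Q : nat -> Prop) :
  eventually P -> (forall m, P m -> Q m) -> eventually Q.
Proof. intros [n H] H'; exists n; auto. Qed.

Lemma eventually_and (P Q : nat -> Prop) :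
  eventually P -> eventually Q -> eventually (fun n => P n /\ Q n).
Proof.
  intros [n H] [m H']; exists (n + m); split; [apply H|apply H']; lia.
Qed.

Lemma eventually_always (P : nat -> Prop) : (forall n, P n) -> eventually P.
Proof. intros H; now exists 0. Qed.

(** Threads are sequences of formulas, terms or substitutions that are eventually
    constant up to weakening. *)
Definition fthread (F : forall n, form (hctx n)) : Prop :=
  eventually (fun n => F (S n) = ren_form (F n) (hwk n)).

Definition tthread s (a : forall n, term (hctx n) s) : Prop :=
  eventually (fun n => a (S n) = ren_term (hwk n) (a n)).

Definition ethread G (f : forall n, sub G (hctx n)) : Prop :=
  eventually (fun n => f (S n) = fun s v => ren_term (hwk n) (f n s v)).

(** Membership, unlike derivability, persists to later stages without a weakening
    lemma for the calculus. *)
Definition holds (F : forall n, form (hctx n)) : Prop :=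
  eventually (fun n => In (F n) (hyps n)).

Lemma pending_length n : length (spending (henkin n)) = S n.
Proof.
  induction n; [reflexivity|]; cbn; rewrite length_app, length_map, IHn; cbn; lia.
Qed.

Lemma pending_last n i : nth n (spending (henkin n)) (fun _ => Bot) i = enum (hctx n) i.
Proof.
  destruct n as [|n]; [reflexivity|].
  cbn; rewrite app_nth2; rewrite length_map, pending_length; [|lia].
  now rewrite Nat.sub_diag.
Qed.

Lemma pending_S n j i : j <= n ->
  nth j (spending (henkin (S n))) (fun _ => Bot) i
  = ren_form (nth j (spending (henkin n)) (fun _ => Bot) i) (hwk n).
Proof.
  intros le; cbn; rewrite app_nth1 by (rewrite length_map, pending_length; lia).
  rewrite (nth_indep _ _ (fun i => ren_form ((fun _ => Bot : form (hctx n)) i) wk))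
    by (rewrite length_map, pending_length; lia).
  now rewrite (map_nth (fun e i => ren_form (e i) wk)).
Qed.

(** Once the thread is stable, its formula at stage j occurs in the enumeration added at stage j.
    That entry and the thread are then weakened in step, until the stage coding the entry is
    reached; this stage is not before j because the pairing dominates its arguments. *)
Lemma candidate_thread F : fthread F ->
  forall n, exists m, n <= m /\ candidate m (henkin m) = F m.
Proof.
  intros [n0 HF] n; set (j := n + n0); destruct (enum_surj (F j)) as [i Hi].
  assert (H : forall m, j <= m ->
    nth j (spending (henkin m)) (fun _ => Bot) i = F m).
  { induction 1 as [|m le IH]; [now rewrite pending_last|].
    rewrite pending_S, IH by exact le; symmetry; apply HF; lia. }
  exists (Cantor.to_nat (i, j)).
  pose proof (Cantor.to_nat_non_decreasing i j).
  unfold candidate; rewrite Cantor.cancel_of_to; cbn [fst snd].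
  split; [|apply H]; lia.
Qed.

Lemma holds_from F n m : (forall k, n <= k -> F (S k) = ren_form (F k) (hwk k)) ->
  n <= m -> In (F m) (hyps m) -> holds F.
Proof.
  intros HF le H; exists m; induction 1 as [|k le' IH]; [exact H|].
  rewrite HF by lia; now apply hyps_S.
Qed.

Lemma fthread_Bot : fthread (fun n => Bot).
Proof. now apply eventually_always. Qed.

Lemma fthread_sub G (p : form G) f : ethread f -> fthread (fun n => sub_form p (f n)).
Proof.
  intros H; apply (eventually_mono H); intros m ->.
  now rewrite ren_form_sub.
Qed.

Lemma ethread_cons G s (f : forall n, sub G (hctx n)) (a : forall n, term (hctx n) s) :
  ethread f -> tthread a -> ethread (fun n => scons (a n) (f n)).
Proof.
  intros H H'; apply (eventually_mono (eventually_and H H')); intros m [-> ->].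
  apply family_ext; apply var_cons_ind; reflexivity.
Qed.

(** A witness is obtained only at one stage. Later stages weaken it, and earlier ones are filled
    with an arbitrary term. *)
Lemma term_thread n s (a : term (hctx n) s) :
  exists b : forall m, term (hctx m) s, b n = a
    /\ forall m, n <= m -> b (S m) = ren_term (hwk m) (b m).
Proof.
  assert (d : forall m, term (hctx m) s)
    by (intros m; clear a; induction s; [exact Zero|exact (App (Pi s2 s1) IHs2)]).
  exists (fix b m := match Nat.eq_dec n m with
    | left e => eq_rect n (fun m => term (hctx m) s) a m e
    | right _ => match m with O => d 0 | S m => ren_term (hwk m) (b m) end
    end).
  split.
  - assert (H : Nat.eq_dec n n = left eq_refl).
    { destruct (Nat.eq_dec n n) as [e|ne]; [|easy].
      f_equal; apply UIP_dec, Nat.eq_dec. }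
    destruct n; now rewrite H.
  - intros m le; destruct (Nat.eq_dec n (S m)); [lia|reflexivity].
Qed.

(** The formula is picked at a stage where the thread is already stable, so the decision made there
    persists along the thread. *)
Lemma decide F : fthread F -> holds F \/ holds (fun n => Imp (F n) Bot).
Proof.
  intros [n HF]; destruct (candidate_thread (ex_intro _ n HF) n) as [m [le Hm]].
  pose proof (decided_in m) as H.
  assert (Hd : decided m (henkin m) = F m \/ decided m (henkin m) = Imp (F m) Bot).
  { unfold decided; rewrite Hm; destruct excluded_middle_informative; auto. }
  destruct Hd as [E|E]; rewrite E in H; [left|right]; apply holds_from with n (S m);
    try lia; try (cbn; rewrite HF by lia; exact H); auto.
  intros k le'; now rewrite HF.
Qed.

Lemma holds_consistent : ~ holds (fun n => Bot).
Proof. intros [n H]; exact (hyps_consistent (prv_hyp T (H n (le_n n)))). Qed.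

(** Closure under derivation follows from decidedness: if the negation held, some stage would
    contain it and derive the formula as well. *)
Lemma holds_deduce F :
  fthread F -> eventually (fun n => prv T (hyps n) (F n)) -> holds F.
Proof.
  intros HF H; destruct (decide HF) as [|H']; [easy|].
  destruct (eventually_and H H') as [n Hn]; destruct (Hn n (le_n n)) as [H1 H2].
  destruct (hyps_consistent (prv_impE (prv_hyp T H2) H1)).
Qed.

Lemma holds_mp F F' : fthread F' ->
  (forall n, prv T (hyps n) (Imp (F n) (F' n))) -> holds F -> holds F'.
Proof.
  intros HF' HI H; apply (holds_deduce HF'), (eventually_mono H).
  intros n Hn; exact (prv_impE (HI n) (prv_hyp T Hn)).
Qed.

Lemma holds_mp2 F F' F'' : fthread F'' ->
  (forall n, prv T (hyps n) (Imp (F n) (Imp (F' n) (F'' n)))) ->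
  holds F -> holds F' -> holds F''.
Proof.
  intros HF' HI H H'; apply (holds_deduce HF'), (eventually_mono (eventually_and H H')).
  intros n [Hn Hn']; exact (prv_impE (prv_impE (HI n) (prv_hyp T Hn)) (prv_hyp T Hn')).
Qed.

Lemma holds_witness G s (p : form (s :: G)) f : ethread f ->
  holds (fun n => sub_form (Ex p) (f n)) ->
  exists a, tthread a /\ holds (fun n => sub_form p (scons (a n) (f n))).
Proof.
  intros Hf H.
  destruct (eventually_and Hf H) as [n Hn].
  destruct (candidate_thread (fthread_sub (Ex p) Hf) n) as [m [le Hm]].
  assert (E : decided m (henkin m) = Ex (sub_form p (sub_up (f m)))).
  (* The candidate is already a hypothesis, so adding it is consistent and it is decided
     positively. *)
  { unfold decided; rewrite Hm; destruct excluded_middle_informative as [|H']; [easy|].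
    destruct H'; intros H'; apply (hyps_consistent (n := m)).
    refine (prv_cut _ H'); apply prv_hyp; now apply Hn. }
  destruct (witness_in E) as [a Ha].
  destruct (term_thread a) as [b [Eb Hb]].
  exists b; split; [now exists (S m)|].
  apply holds_from with (S m) (S m); [|lia|].
  - intros k le'; rewrite (Hb k le'); destruct (Hn k ltac:(lia)) as [-> _].
    rewrite ren_form_sub; f_equal; apply family_ext; apply var_cons_ind; reflexivity.
  - rewrite Eb; destruct (Hn m le) as [-> _].
    rewrite sub_form_sub in Ha; refine (eq_ind _ (fun q => In q _) Ha _ _).
    f_equal; apply family_ext; apply var_cons_ind; intros; cbn; [reflexivity|].
    rewrite sub_term_ren, ren_term_as_sub; reflexivity.
Qed.

(** If the universal formula failed, a counterexample would be existentially asserted, and its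
    Henkin witness would contradict the hypothesis. *)
Lemma holds_all G s (p : form (s :: G)) f : ethread f ->
  (forall a, tthread a -> holds (fun n => sub_form p (scons (a n) (f n)))) ->
  holds (fun n => sub_form (All p) (f n)).
Proof.
  intros Hf H.
  destruct (decide (fthread_sub (Ex (Imp p Bot)) Hf)) as [H'|H'].
  - destruct (holds_witness Hf H') as [a [Ha Hn]].
    destruct holds_consistent.
    refine (holds_mp2 fthread_Bot _ Hn (H a Ha)); intros n; cbn.
    now apply prv_impI, prv_hyp; left.
  - refine (holds_mp (fthread_sub (All p) Hf) _ H').
    intros n; apply not_ex_not_all.
Qed.

(** * The term model *)

Definition equiv s (a b : forall n, term (hctx n) s) : Prop :=
  holds (fun n => eqt (a n) (b n)).

Lemma fthread_eqt s (a b : forall n, term (hctx n) s) :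
  tthread a -> tthread b -> fthread (fun n => eqt (a n) (b n)).
Proof.
  intros H H'; apply (eventually_mono (eventually_and H H')); intros n [-> ->].
  now rewrite ren_eqt.
Qed.

Lemma equiv_refl s (a : forall n, term (hctx n) s) : tthread a -> equiv a a.
Proof.
  intros H; apply (holds_deduce (fthread_eqt H H)), eventually_always.
  intros n; now apply eqt_refl.
Qed.

Lemma equiv_sym s (a b : forall n, term (hctx n) s) :
  tthread a -> tthread b -> equiv a b -> equiv b a.
Proof.
  intros Ha Hb; apply (holds_mp (fthread_eqt Hb Ha)); intros n; now apply eqt_sym.
Qed.

Lemma equiv_trans s (a b c : forall n, term (hctx n) s) :
  tthread a -> tthread c -> equiv a b -> equiv b c -> equiv a c.
Proof.
  intros Ha Hc; apply (holds_mp2 (fthread_eqt Ha Hc)); intros n; now apply eqt_trans.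
Qed.

(** An element is an equivalence class of term threads, given as a predicate, so that equivalent
    threads yield equal elements by propositional extensionality and proof irrelevance. *)
Definition hcar (s : ty) : Type :=
  {P : (forall n, term (hctx n) s) -> Prop |
    exists a, tthread a /\ P = fun b => tthread b /\ equiv a b}.

Definition den s (x : hcar s) (a : forall n, term (hctx n) s) : Prop := proj1_sig x a.

Definition cls s (a : forall n, term (hctx n) s) (H : tthread a) : hcar s :=
  exist _ (fun b => tthread b /\ equiv a b) (ex_intro _ a (conj H eq_refl)).

Lemma den_cls s (a : forall n, term (hctx n) s) (H : tthread a) : den (cls H) a.
Proof. split; [exact H|now apply equiv_refl]. Qed.

Lemma den_exists s (x : hcar s) : exists a, den x a.
Proof.
  destruct x as [P [a [H ->]]]; exists a; split; [exact H|now apply equiv_refl].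
Qed.

Lemma den_tthread s (x : hcar s) a : den x a -> tthread a.
Proof. destruct x as [P [b [H ->]]]; now intros [H' _]. Qed.

Lemma den_eq s (x y : hcar s) a b : den x a -> den y b -> (x = y <-> equiv a b).
Proof.
  destruct x as [P [a' [Ha ->]]], y as [Q [b' [Hb ->]]]; unfold den; cbn.
  intros [Ha' E] [Hb' E']; split; intros H.
  - apply (f_equal (@proj1_sig _ _)) in H; cbn in H.
    assert (H' : (fun b => tthread b /\ equiv b' b) b) by easy.
    rewrite <- H in H'; destruct H' as [_ H'].
    exact (equiv_trans Ha' Hb' (equiv_sym Ha Ha' E) H').
  - assert (F : equiv a' b').
    { apply equiv_trans with b; auto; [apply equiv_trans with a; auto|].
      now apply equiv_sym. }
    assert (F' := equiv_sym Ha Hb F).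
    apply eq_sig_hprop; [intros; apply proof_irrelevance|cbn].
    apply functional_extensionality; intros c; apply propositional_extensionality.
    split; intros [Hc Hc']; split; auto;
      [apply equiv_trans with a'|apply equiv_trans with b']; auto.
Qed.

Lemma den_equiv s (x : hcar s) a b : den x a -> tthread b -> equiv a b -> den x b.
Proof.
  intros H Hb E; replace x with (cls Hb); [apply den_cls|].
  apply (den_eq (den_cls Hb) H), equiv_sym; auto; exact (den_tthread H).
Qed.

Definition rep s (x : hcar s) : forall n, term (hctx n) s :=
  proj1_sig (constructive_indefinite_description _ (den_exists x)).

Lemma den_rep s (x : hcar s) : den x (rep x).
Proof. unfold rep; now destruct constructive_indefinite_description. Qed.

Lemma tthread_App s t (a : forall n, term (hctx n) (s ⟶ t)%ty) b :
  tthread a -> tthread b -> tthread (fun n => App (a n) (b n)).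
Proof.
  intros H H'; apply (eventually_mono (eventually_and H H')); now intros n [-> ->].
Qed.

Definition hap s t (x : hcar (s ⟶ t)%ty) (y : hcar s) : hcar t :=
  cls (tthread_App (den_tthread (den_rep x)) (den_tthread (den_rep y))).

Lemma den_hap s t (x : hcar (s ⟶ t)%ty) (y : hcar s) a b :
  den x a -> den y b -> den (hap x y) (fun n => App (a n) (b n)).
Proof.
  intros H H'; eapply den_equiv; [apply den_cls| |].
  - exact (tthread_App (den_tthread H) (den_tthread H')).
  - refine (holds_mp2 _ _ (proj1 (den_eq (den_rep x) H) eq_refl)
      (proj1 (den_eq (den_rep y) H') eq_refl)).
    + exact (fthread_eqt (tthread_App (den_tthread (den_rep x)) (den_tthread (den_rep y)))
        (tthread_App (den_tthread H) (den_tthread H'))).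
    + intros n; now apply eqt_cong.
Qed.

Lemma tthread_const s (a : forall G, term G s) :
  (forall G D (r : ren G D), a D = ren_term r (a G)) -> tthread (fun n => a (hctx n)).
Proof. intros H; now apply eventually_always. Qed.

Definition hlt (x y : hcar N) : Prop := holds (fun n => Lt (rep x n) (rep y n)).

Lemma fthread_Lt (a b : forall n, term (hctx n) N) :
  tthread a -> tthread b -> fthread (fun n => Lt (a n) (b n)).
Proof.
  intros H H'; apply (eventually_mono (eventually_and H H')); now intros n [-> ->].
Qed.

(** Independence of the chosen representatives, by congruence of the order with respect to
    equality. *)
Lemma hlt_den x y a b : den x a -> den y b -> (hlt x y <-> holds (fun n => Lt (a n) (b n))).
Proof.
  assert (K : forall a b a' b' x y, den x a -> den x a' -> den y b -> den y b' ->
    holds (fun n => Lt (a n) (b n)) -> holds (fun n => Lt (a' n) (b' n))).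
  { clear a b x y; intros a b a' b' x y Ha Ha' Hb Hb' H.
    pose proof (proj1 (den_eq Ha Ha') eq_refl) as E.
    pose proof (proj1 (den_eq Hb Hb') eq_refl) as E'.
    assert (F := fthread_Lt (den_tthread Ha') (den_tthread Hb')).
    apply (holds_deduce F), (eventually_mono (eventually_and E (eventually_and E' H))).
    intros n [H1 [H2 H3]].
    refine (prv_impE (prv_impE (prv_impE (Lt_cong Teq _ _ _ _ _) _) _) _);
      apply prv_hyp; eassumption. }
  intros Ha Hb; split; apply (K _ _ _ _ x y); auto using den_rep.
Qed.

Definition nil_sub D : sub [] D := fun s v =>
  match v in var G s return match G with [] => term D s | _ => unit end with
  | vz => tt
  | vs _ => tt
  end.

Lemma nil_family_ext (P : ty -> Type) (f g : forall s, var [] s -> P s) : f = g.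
Proof.
  apply family_ext; intros s v.
  exact (match v in var G s return match G return var G s -> Prop with
    | [] => fun v => forall f g : forall s, var [] s -> P s, f s v = g s v
    | _ => fun _ => Logic.True end v with vz => I | vs _ => I end f g).
Qed.

Lemma ethread_nil : ethread (fun n => nil_sub (hctx n)).
Proof. apply eventually_always; intros n; apply nil_family_ext. Qed.

(** Equality at an arrow type is by definition a universal formula, and [holds_all] reduces that
    formula to its instances at threads, where the hypothesis applies. *)
Lemma hap_ext s t (x y : hcar (s ⟶ t)%ty) : (forall z, hap x z = hap y z) -> x = y.
Proof.
  intros H; pose proof (den_rep x) as Hx; pose proof (den_rep y) as Hy.
  apply (den_eq Hx Hy).
  set (f n := scons (rep x n) (scons (rep y n) (nil_sub (hctx n)))).
  assert (Hf : ethread f).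
  { repeat apply ethread_cons; try apply ethread_nil; eauto using den_tthread. }
  set (p := eqt (App (Var (vs vz)) (Var vz)) (App (Var (vs (vs vz))) (Var vz))
    : form [s; (s ⟶ t)%ty; (s ⟶ t)%ty]).
  pose proof (holds_all (p := p) Hf) as K; cbn in K.
  refine (eq_ind _ holds (K _) _ _); clear K.
  - intros a Ha; unfold p; specialize (H (cls Ha)).
    pose proof (proj1 (den_eq (den_hap Hx (den_cls Ha)) (den_hap Hy (den_cls Ha))) H) as E.
    refine (eq_ind _ holds E _ _).
    apply functional_extensionality_dep; intros n; now rewrite sub_eqt.
  - apply functional_extensionality_dep; intros n; unfold p; rewrite sub_eqt; reflexivity.
Qed.

Definition hconst s (a : forall G, term G s)
  (H : forall G D (r : ren G D), a D = ren_term r (a G)) : hcar s :=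
  cls (tthread_const H).

Definition term_model : model := {|
  car := hcar;
  ap := hap;
  m0 := hconst (a := @Zero) (fun _ _ _ => eq_refl);
  m1 := hconst (a := @One) (fun _ _ _ => eq_refl);
  mplus := hconst (a := @Plus) (fun _ _ _ => eq_refl);
  mtimes := hconst (a := @Times) (fun _ _ _ => eq_refl);
  mPi := fun s t => hconst (a := fun G => Pi s t) (fun _ _ _ => eq_refl);
  mSigma := fun r s t => hconst (a := fun G => Sigma r s t) (fun _ _ _ => eq_refl);
  mRec := hconst (a := @Rec) (fun _ _ _ => eq_refl);
  mlt := hlt;
  ap_ext := hap_ext
|}.

Definition den_env G (e : env term_model G) (f : forall n, sub G (hctx n)) : Prop :=
  forall s v, den (e s v) (fun n => f n s v).

Lemma den_env_cons G (e : env term_model G) f s (x : car term_model s) a :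
  den_env e f -> den x a -> den_env (econs x e) (fun n => scons (a n) (f n)).
Proof. intros He Hx; unfold den_env; now apply var_cons_ind. Qed.

Lemma eval_den G s (a : term G s) (e : env term_model G) f :
  den_env e f -> den (eval a e) (fun n => sub_term (f n) a).
Proof.
  intros He; induction a; cbn; [apply He|exact (den_hap IHa1 IHa2)|..];
    (split; [|apply equiv_refl]; now apply eventually_always).
Qed.

(** The truth lemma: implication and disjunction rest on the fact that every thread is decided, the
    quantifiers on Henkin witnesses. *)
Lemma sat_holds G (p : form G) : forall (e : env term_model G) f,
  ethread f -> den_env e f -> (sat p e <-> holds (fun n => sub_form p (f n))).
Proof.
  induction p as [G a b|G a b|G|G p IHp q IHq|G p IHp q IHq|G p IHp q IHq|G s p IH|G s p IH];
    intros e f Hf He; pose proof (fun p => fthread_sub p Hf) as Hs; cbn.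
  - exact (den_eq (eval_den a He) (eval_den b He)).
  - exact (hlt_den (eval_den a He) (eval_den b He)).
  - split; [easy|exact holds_consistent].
  - rewrite (IHp e f), (IHq e f) by assumption; split.
    + intros H; destruct (decide (Hs p)) as [Hp|Hp].
      * refine (holds_mp (Hs (Imp p q)) _ (H Hp)); intros n.
        apply prv_impI, prv_impI, prv_hyp; cbn; auto.
      * refine (holds_mp (Hs (Imp p q)) _ Hp); intros n.
        apply prv_impI, prv_impI, prv_botE.
        eapply prv_impE; apply prv_hyp; cbn; auto.
    + intros H Hp; refine (holds_mp2 (Hs q) _ H Hp); intros n.
      apply prv_impI, prv_hyp; now left.
  - rewrite (IHp e f), (IHq e f) by assumption; split.
    + intros [H H']; refine (holds_mp2 (Hs (And p q)) _ H H'); intros n.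
      apply prv_impI, prv_impI, prv_andI; apply prv_hyp; cbn; auto.
    + intros H; split; [refine (holds_mp (Hs p) _ H)|refine (holds_mp (Hs q) _ H)];
        intros n; apply prv_impI; [eapply prv_andE1|eapply prv_andE2];
        apply prv_hyp; now left.
  - rewrite (IHp e f), (IHq e f) by assumption; split.
    + intros [H|H]; refine (holds_mp (Hs (Or p q)) _ H); intros n;
        apply prv_impI; [apply prv_orI1|apply prv_orI2]; apply prv_hyp; now left.
    + intros H; destruct (decide (Hs p)) as [Hp|Hp]; [now left|right].
      refine (holds_mp2 (Hs q) _ H Hp); intros n.
      apply prv_impI, prv_impI; eapply prv_orE; [apply prv_hyp; right; now left| |].
      * apply prv_botE; eapply prv_impE; apply prv_hyp; cbn; auto.
      * apply prv_hyp; now left.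
  - split.
    + intros H; apply (holds_all Hf); intros a Ha.
      apply (IH (econs (cls Ha : car term_model s) e));
        [now apply ethread_cons|apply den_env_cons; [easy|apply den_cls]|apply H].
    + intros H x; pose proof (ethread_cons Hf (den_tthread (den_rep x))) as Hx.
      apply (IH _ _ Hx); [apply den_env_cons; [easy|apply den_rep]|].
      refine (holds_mp (fthread_sub p Hx) _ H); intros n; apply prv_impI.
      rewrite <- inst_sub_up; apply prv_allE, prv_hyp; now left.
  - split.
    + intros [x H]; pose proof (ethread_cons Hf (den_tthread (den_rep x))) as Hx.
      apply (IH _ _ Hx) in H; [|apply den_env_cons; [easy|apply den_rep]].
      refine (holds_mp (Hs (Ex p)) _ H); intros n; apply prv_impI.
      apply prv_exI with (a := rep x n); rewrite inst_sub_up; apply prv_hyp; now left.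
    + intros H; destruct (holds_witness Hf H) as [a [Ha H']].
      exists (cls Ha); apply (IH _ (fun n => scons (a n) (f n)));
        [now apply ethread_cons|apply den_env_cons; [easy|apply den_cls]|exact H'].
Qed.

(** A context is finite, so the threads chosen for its variables have a common stage after which all
    are stable. *)
Lemma den_env_exists G (e : env term_model G) : exists f, ethread f /\ den_env e f.
Proof.
  exists (fun n s v => rep (e s v) n); split; [|intros s v; apply den_rep].
  assert (H : forall s v, tthread (rep (e s v))) by (intros; eapply den_tthread, den_rep).
  induction G as [|t G IH].
  - apply eventually_always; intros n; apply nil_family_ext.
  - apply (eventually_mono (eventually_and (H t vz)
      (IH (fun s v => e s (vs v)) (fun s v => H s (vs v))))).
    intros n [H1 H2]; apply family_ext; apply var_cons_ind; [exact H1|].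
    intros s v; exact (f_equal (fun g => g s v) H2).
Qed.

Lemma term_model_sat G (p : form G) (e : env term_model G) : T p -> sat p e.
Proof.
  intros H; destruct (den_env_exists e) as [f [Hf He]].
  apply (sat_holds p Hf He), (holds_deduce (fthread_sub p Hf)), eventually_always.
  intros n; now apply prv_ax, Tsub.
Qed.

Lemma term_model_not_sat : ~ sat p0 (nil_env term_model).
Proof.
  intros H.
  apply (sat_holds p0 ethread_nil) in H; [|intros s v; inversion v].
  assert (H0 : holds (fun n => sub_form (Imp p0 Bot) (nil_sub (hctx n)))).
  { apply holds_from with 0 0; [|lia|].
    - intros k _; rewrite ren_form_sub; f_equal; apply nil_family_ext.
    - left; transitivity (sub_form (Imp p0 Bot) (fun s v => Var v));
        [symmetry; apply sub_form_id|f_equal; apply nil_family_ext]. }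
  apply holds_consistent; refine (holds_mp2 fthread_Bot _ H0 H); intros n.
  apply prv_impI, prv_hyp; now left.
Qed.

End Completeness.

Definition satisfies (M : model) (T : theory) : Prop :=
  forall G (p : form G) (e : env M G), T G p -> sat p e.

Theorem completeness (T : theory) (p : form []) :
  axioms_in T equality_axioms -> (forall G r t, T G (ext_axiom G r t)) -> sub_closed T ->
  (forall M, satisfies M T -> sat p (nil_env M)) -> proves T p.
Proof.
  intros Teq Text Tsub H; apply NNPP; intros Hp.
  apply (term_model_not_sat (Teq := Teq) (Text := Text) (p0_unprovable := Hp)), H.
  intros G q e; now apply term_model_sat.
Qed.

(** Abstraction of the variables that [r] recognizes, by combinators. *)
Fixpoint bracket (G D : ctx) (s t : ty)
    (r : forall u, var G u -> ((s = u) + var D u)%type) (a : term G t) : term D (s ⟶ t) :=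
  let K u (b : term D u) : term D (s ⟶ u) := App (Pi u s) b in
  match a in term _ t return term D (s ⟶ t) with
  | Var v =>
      match r _ v with
      | inl e => eq_rect s (fun u => term D (s ⟶ u))
                   (App (App (Sigma s (N ⟶ s) s) (Pi s (N ⟶ s))) (Pi s N)) _ e
      | inr w => K _ (Var w)
      end
  | App b c => App (App (Sigma _ _ _) (bracket r b)) (bracket r c)
  | Zero => K _ Zero
  | One => K _ One
  | Plus => K _ Plus
  | Times => K _ Times
  | Pi u t => K _ (Pi u t)
  | Sigma u v w => K _ (Sigma u v w)
  | Rec => K _ Rec
  end.

Definition lam (G : ctx) (s t : ty) (a : term (s :: G) t) : term G (s ⟶ t) :=
  bracket (var_case (P := fun u => ((s = u) + var G u)%type) (inl eq_refl)
    (fun u v => inr v)) a.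

(** * Arithmetic and comprehension in a model *)

Declare Scope model_scope.
Delimit Scope model_scope with m.

Section Model.
Context (M : model) (HM : satisfies M ACA0w_IND).

Definition num : Type := car M N.
Definition add (x y : num) : num := ap (ap mplus x) y.
Definition mul (x y : num) : num := ap (ap mtimes x) y.
Definition lt (x y : num) : Prop := mlt x y.
Definition le (x y : num) : Prop := lt x y \/ x = y.
Definition zero : num := m0.
Definition one : num := m1.

Notation "0" := zero : model_scope.
Notation "1" := one : model_scope.
Infix "+" := add : model_scope.
Infix "*" := mul : model_scope.
Infix "<" := lt : model_scope.
Infix "<=" := le : model_scope.
Local Open Scope model_scope.

Lemma sat_RCA0w G (p : form G) e : RCA0w p -> sat (M := M) p e.
Proof. intros H; apply HM; now apply ACA0w_IND_base, ACA0w_RCA0w. Qed.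

Lemma sat_semiring n : (n < 15)%nat ->
  sat (nth n (ordered_semiring_axioms []) Bot) (nil_env M).
Proof. intros H; now apply sat_RCA0w, RCA0w_semiring, nth_In. Qed.

Ltac semiring n := exact (sat_semiring (n := n) ltac:(lia)).

Lemma add_assoc : forall x y z, (x + y) + z = x + (y + z). Proof. semiring 0%nat. Qed.
Lemma add_comm : forall x y, x + y = y + x. Proof. semiring 1%nat. Qed.
Lemma add_0_r : forall x, x + 0 = x. Proof. semiring 2%nat. Qed.
Lemma mul_assoc : forall x y z, (x * y) * z = x * (y * z). Proof. semiring 3%nat. Qed.
Lemma mul_comm : forall x y, x * y = y * x. Proof. semiring 4%nat. Qed.
Lemma mul_1_r : forall x, x * 1 = x. Proof. semiring 5%nat. Qed.
Lemma mul_0_r : forall x, x * 0 = 0. Proof. semiring 6%nat. Qed.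
Lemma mul_add_r : forall x y z, x * (y + z) = x * y + x * z. Proof. semiring 7%nat. Qed.
Lemma lt_irrefl : forall x, ~ x < x. Proof. semiring 8%nat. Qed.
Lemma lt_trans : forall x y z, x < y -> y < z -> x < z. Proof. semiring 9%nat. Qed.
Lemma lt_total : forall x y, x < y \/ x = y \/ y < x. Proof. semiring 10%nat. Qed.
Lemma add_lt_l : forall x y z, x < y -> x + z < y + z. Proof. semiring 11%nat. Qed.
Lemma mul_lt_l : forall x y z, 0 < z -> x < y -> x * z < y * z. Proof. semiring 12%nat. Qed.
Lemma lt_0_1 : 0 < 1. Proof. semiring 13%nat. Qed.
Lemma le_0_l : forall x, 0 <= x. Proof. semiring 14%nat. Qed.

Lemma num_semiring : semi_ring_theory 0 1 add mul eq.
Proof.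
  split; intros.
  - now rewrite add_comm, add_0_r.
  - apply add_comm.
  - now rewrite add_assoc.
  - now rewrite mul_comm, mul_1_r.
  - now rewrite mul_comm, mul_0_r.
  - apply mul_comm.
  - now rewrite mul_assoc.
  - rewrite mul_comm, mul_add_r, (mul_comm _ n), (mul_comm _ m); reflexivity.
Qed.
Add Ring num_ring : num_semiring.


(** Induction inside the model needs a formula with parameters. Later uses therefore write the
    statement as a formula and return to its meaning with [change]. *)
Lemma model_ind G (p : form (N :: G)) (e : env M G) :
  sat p (econs 0 e) -> (forall x, sat p (econs x e) -> sat p (econs (x + 1) e)) ->
  forall x, sat p (econs x e).
Proof.
  intros H0 HS; pose proof (HM e (ACA0w_IND_scheme p)) as H; cbn in H; apply H; split.
  - apply sat_sub; refine (eq_ind _ (sat p) H0 _ _).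
    apply family_ext; apply var_cons_ind; reflexivity.
  - intros x Hx; apply sat_sub; refine (eq_ind _ (sat p) (HS x Hx) _ _).
    apply family_ext; apply var_cons_ind; reflexivity.
Qed.

Lemma le_refl x : x <= x. Proof. now right. Qed.
Lemma lt_le x y : x < y -> x <= y. Proof. now left. Qed.

Lemma lt_le_trans x y z : x < y -> y <= z -> x < z.
Proof. intros H [H'| <-]; [eapply lt_trans|]; eauto. Qed.

Lemma le_lt_trans x y z : x <= y -> y < z -> x < z.
Proof. intros [H| ->] H'; [eapply lt_trans|]; eauto. Qed.

Lemma le_trans x y z : x <= y -> y <= z -> x <= z.
Proof. intros H [H'| <-]; [left; eapply le_lt_trans|]; eauto. Qed.

Lemma lt_or_le x y : x < y \/ y <= x.
Proof. destruct (lt_total x y) as [H|[->|H]]; [left|right; right|right; left]; auto. Qed.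

Lemma lt_not_le x y : x < y -> ~ y <= x.
Proof. intros H H'; apply (@lt_irrefl x); eapply lt_le_trans; eauto. Qed.

Lemma le_antisym x y : x <= y -> y <= x -> x = y.
Proof. intros [H|H] H'; [now destruct (lt_not_le H)|easy]. Qed.

Lemma add_lt_inv x y z : x + z < y + z -> x < y.
Proof.
  intros H; destruct (lt_or_le x y) as [|[H'| ->]]; auto;
    destruct (lt_irrefl (x := x + z)); auto.
  exact (lt_trans H (add_lt_l z H')).
Qed.

Lemma add_cancel x y z : x + z = y + z -> x = y.
Proof.
  intros H; destruct (lt_total x y) as [H'|[|H']]; auto;
    apply (add_lt_l z) in H'; rewrite H in H'; now destruct (lt_irrefl H').
Qed.

Lemma add_le x x' y y' : x <= x' -> y <= y' -> x + y <= x' + y'.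
Proof.
  intros H H'; apply le_trans with (x' + y).
  - destruct H as [H| ->]; [left; now apply add_lt_l|apply le_refl].
  - rewrite !(add_comm x').
    destruct H' as [H'| ->]; [left; now apply add_lt_l|apply le_refl].
Qed.

Lemma le_add_r x y : x <= x + y.
Proof. rewrite <- (add_0_r x) at 1; apply add_le; [apply le_refl|apply le_0_l]. Qed.

Lemma lt_add_1 x : x < x + 1.
Proof.
  pose proof (add_lt_l x lt_0_1) as H.
  rewrite (add_comm 0), add_0_r, add_comm in H; exact H.
Qed.

(** The semiring axioms alone admit dense orders, such as the nonnegative reals; discreteness comes
    from induction. *)
Lemma zero_or_succ x : x = 0 \/ exists y, x = y + 1.
Proof.
  apply (model_ind
    (p := (Var vz = 0 \/ EX y : N, Var (vs vz) = y + 1)%form)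
    (e := nil_env M)).
  - now left.
  - intros y _; right; now exists y.
Qed.

Lemma le_exists x y : x <= y -> exists z, y = x + z.
Proof.
  revert x.
  refine (model_ind
    (p := (ALL x : N, x <= Var (vs vz) ==> EX z : N, Var (vs (vs vz)) = ↑x + z)%form)
    (e := nil_env M) _ _ y).
  - intros x H; exists 0; cbn; change (0 = x + 0); rewrite add_0_r.
    apply le_antisym; [apply le_0_l|exact H].
  - intros n IH x H; change (x <= n + 1) in H.
    change (forall x : num, x <= n -> exists z, n = x + z) in IH.
    change (exists z, n + 1 = x + z).
    destruct (zero_or_succ x) as [->|[x' ->]]; [exists (n + 1); ring|].
    destruct (IH x') as [z ->]; [|exists z; ring].
    destruct H as [H|H]; [left|right]; [exact (add_lt_inv H)|exact (add_cancel H)].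
Qed.

Lemma lt_exists x y : x < y -> exists z, y = x + z + 1.
Proof.
  intros H; destruct (le_exists (lt_le H)) as [z ->].
  destruct (zero_or_succ z) as [->|[z' ->]]; [|exists z'; ring].
  rewrite add_0_r in H; now destruct (lt_irrefl H).
Qed.

Lemma le_intro z x y : y = x + z -> x <= y.
Proof. intros ->; apply le_add_r. Qed.

Lemma lt_intro z x y : y = x + z + 1 -> x < y.
Proof. intros ->; eapply le_lt_trans; [apply le_add_r|apply lt_add_1]. Qed.

Lemma lt_succ x y : x < y + 1 <-> x <= y.
Proof.
  split; intros H.
  - destruct (lt_exists H) as [z Hz]; apply add_cancel in Hz.
    now apply le_intro with z.
  - eapply le_lt_trans; [exact H|apply lt_add_1].
Qed.

Lemma succ_neq_0 x : x + 1 <> 0.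
Proof. intros H; apply (lt_not_le (lt_add_1 x)); rewrite H; apply le_0_l. Qed.

Lemma pos_succ x : 0 < x -> exists y, x = y + 1.
Proof. intros H; destruct (lt_exists H) as [z ->]; exists z; ring. Qed.

Lemma mul_pos x y : 0 < x -> 0 < y -> 0 < x * y.
Proof.
  intros H H'; destruct (pos_succ H) as [a ->], (pos_succ H') as [b ->].
  apply lt_intro with (a * b + a + b); ring.
Qed.

Lemma add_lt_le x x' y y' : x < x' -> y <= y' -> x + y < x' + y'.
Proof.
  intros H H'; eapply lt_le_trans; [apply add_lt_l, H|].
  apply add_le; [apply le_refl|exact H'].
Qed.

Lemma mul_le x x' y y' : x <= x' -> y <= y' -> x * y <= x' * y'.
Proof.
  intros H H'; destruct (le_exists H) as [a ->], (le_exists H') as [b ->].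
  apply le_intro with (x * b + a * y + a * b); ring.
Qed.

Lemma mul_lt_inv x y z : x * z < y * z -> x < y.
Proof.
  intros H; destruct (lt_or_le x y) as [|H']; [easy|].
  destruct (lt_not_le H); now apply mul_le; [|apply le_refl].
Qed.

Definition pair (a b : num) : num := (a + b) * (a + b) + a.

(** With s = a + b, a code lies between s^2 and s^2 + s, hence below (s + 1)^2. Codes with different
    sums are therefore separated. *)
Lemma pair_lt a b a' b' : a + b < a' + b' -> pair a b < pair a' b'.
Proof.
  intros H; destruct (lt_exists H) as [z Hz]; unfold pair; rewrite Hz.
  apply lt_intro with (b + z + a + b + z + (a+b) * z + (a + b) * z + z * z + a'); ring.
Qed.

Lemma pair_inj a b a' b' : pair a b = pair a' b' -> a = a' /\ b = b'.
Proof.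
  intros H.
  assert (E : a + b = a' + b').
  { destruct (lt_total (a + b) (a' + b')) as [L|[E|L]]; auto;
      apply pair_lt in L; rewrite H in L; now destruct (lt_irrefl L). }
  unfold pair in H; rewrite E, !(add_comm (_ * _)) in H; apply add_cancel in H.
  subst a'; split; [easy|]; rewrite !(add_comm a) in E; exact (add_cancel E).
Qed.

Lemma ap_Pi s t (x : car M s) (y : car M t) : ap (ap (mPi M s t) x) y = x.
Proof.
  pose proof (sat_RCA0w (nil_env M) (RCA0w_Pi [] s t)) as H.
  exact (proj1 (sat_eqt _ _ _) (H x y)).
Qed.

Lemma ap_Sigma r s t (x : car M (r ⟶ s ⟶ t)%ty) y z :
  ap (ap (ap (mSigma M r s t) x) y) z = ap (ap x z) (ap y z).
Proof.
  pose proof (sat_RCA0w (nil_env M) (RCA0w_Sigma [] r s t)) as H.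
  exact (proj1 (sat_eqt _ _ _) (H x y z)).
Qed.

Lemma ap_Rec_0 f (m : num) : ap (ap (ap (mRec M) f) m) 0 = m.
Proof.
  exact (proj1 (sat_RCA0w (nil_env M) (RCA0w_Rec []) f m)).
Qed.

Lemma ap_Rec_S f (m n : num) :
  ap (ap (ap (mRec M) f) m) (n + 1)
  = ap (ap f n) (ap (ap (ap (mRec M) f) m) n).
Proof.
  exact (proj2 (sat_RCA0w (nil_env M) (RCA0w_Rec []) f m) n).
Qed.

Lemma eval_bracket G D s t (r : forall u, var G u -> ((s = u) + var D u)%type)
    (a : term G t) (e : env M G) (e' : env M D) x :
  (forall u v, e u v = match r u v with
                       | inl E => eq_rect s (car M) x u E
                       | inr w => e' u w
                       end) ->
  ap (eval (bracket r a) e') x = eval a e.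
Proof.
  intros H; induction a; cbn; rewrite ?ap_Pi, ?ap_Sigma; try reflexivity; [|congruence].
  rewrite H; destruct (r s0 v) as [<-|w]; cbn; rewrite ?ap_Sigma, ap_Pi; reflexivity.
Qed.

Lemma eval_lam G s t (a : term (s :: G) t) (e : env M G) x :
  ap (eval (lam a) e) x = eval a (econs x e).
Proof. apply eval_bracket; now apply var_cons_ind. Qed.

Lemma sat_ren G D (r : ren G D) (p : form G) (e : env M D) :
  sat (ren_form p r) e <-> sat p (fun s v => e s (r s v)).
Proof. rewrite ren_form_as_sub; apply sat_sub. Qed.

Lemma qf_choice G (p : form (N :: ty1 :: G)) (e : env M G) : qf p ->
  (forall x, exists y, sat p (econs y (econs x e))) ->
  exists Y : car M ty2, forall x, sat p (econs (ap Y x) (econs x e)).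
Proof.
  intros Hp H; destruct (sat_RCA0w e (RCA0w_QFAC10 Hp) H) as [Y HY].
  exists Y; intros x; specialize (HY x); apply sat_sub in HY.
  refine (eq_ind _ (sat p) HY _ _).
  apply family_ext; apply var_cons_ind; [reflexivity|]; now apply var_cons_ind.
Qed.

(** Choice is applied to the quantifier-free formula stating that p holds and y = 1, or p fails and
    y = 0; excluded middle provides the y. *)
Lemma qf_characteristic G (p : form (ty1 :: G)) (e : env M G) : qf p ->
  exists X : car M ty2, forall f,
    sat p (econs f e) /\ ap X f = 1 \/ ~ sat p (econs f e) /\ ap X f = 0.
Proof.
  intros Hp; set (p' := ren_form p (wk (t := N))).
  assert (Hp' : qf p') by (unfold p'; rewrite ren_form_as_sub; now apply qf_sub).
  assert (E : forall y f, sat p' (econs y (econs f e)) <-> sat p (econs f e)).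
  { intros y f; exact (sat_ren _ _ _). }
  destruct (qf_choice (p := Or (And p' (Eq (Var vz) One))
      (And (Imp p' Bot) (Eq (Var vz) Zero))) (e := e)) as [X HX].
  - cbn; auto.
  - intros f; destruct (classic (sat p (econs f e))) as [H|H].
    + exists 1; left; split; [now apply E|reflexivity].
    + exists 0; right; split; [|reflexivity]; intros H'; now apply H, (E 0 f).
  - exists X; intros f; destruct (HX f) as [[H H']|[H H']]; [left|right]; split; auto.
    + now apply E in H.
    + intros H''; now apply H, (E (ap X f) f).
Qed.

Definition seq_cons_m (n : num) (f : car M ty1) : car M ty1 :=
  eval (seq_cons (Var vz) (Var (vs vz))) (econs n (econs f (nil_env M))).

Lemma seq_cons_0 n f : ap (seq_cons_m n f) 0 = n.
Proof. apply ap_Rec_0. Qed.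

Lemma seq_cons_S n f k : ap (seq_cons_m n f) (k + 1) = ap f k.
Proof.
  unfold seq_cons_m; cbn.
  etransitivity; [apply ap_Rec_S|].
  now rewrite !ap_Sigma, !ap_Pi.
Qed.

(** * Rational and real numbers in a model *)

Definition pow2 (n : num) : num := eval (exp2 (Var vz)) (econs n (nil_env M)).

Arguments pow2 : simpl never.

Lemma pow2_0 : pow2 0 = 1.
Proof. apply ap_Rec_0. Qed.

Lemma pow2_S n : pow2 (n + 1) = pow2 n + pow2 n.
Proof.
  unfold pow2; cbn; etransitivity; [apply ap_Rec_S|].
  now rewrite !ap_Pi, !ap_Sigma, !ap_Pi.
Qed.

Lemma lt_pow2 n : n < pow2 n.
Proof.
  refine (model_ind (p := Lt (Var vz) (exp2 (Var vz))) (e := nil_env M) _ _ n);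
    clear n.
  - change (0 < pow2 0); rewrite pow2_0; apply lt_0_1.
  - intros n H; change (n < pow2 n) in H; change (n + 1 < pow2 (n + 1)).
    rewrite pow2_S; destruct (lt_exists H) as [z ->].
    apply lt_intro with (n + z + z); ring.
Qed.

Lemma pow2_pos n : 0 < pow2 n.
Proof. eapply le_lt_trans; [apply le_0_l|apply lt_pow2]. Qed.

Record rat : Type := Rat { rpos : num; rneg : num; rden : num }.

Definition rat0 : rat := Rat 0 0 1.
Definition rpow (n : num) : rat := Rat 1 0 (pow2 n).
Definition rpow' (n : num) : rat := Rat (1 + 1) 0 (pow2 n).

Definition radd (p q : rat) : rat :=
  Rat (rpos p * rden q + rpos q * rden p)
      (rneg p * rden q + rneg q * rden p)
      (rden p * rden q).

Definition rlt (p q : rat) : Prop :=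
  rpos p * rden q + rneg q * rden p < rpos q * rden p + rneg p * rden q.

Definition rle (p q : rat) : Prop :=
  rpos p * rden q + rneg q * rden p <= rpos q * rden p + rneg p * rden q.

Definition rcode (p : rat) : num := pair (pair (rpos p) (rneg p)) (rden p).

Lemma rcode_inj p q : rcode p = rcode q -> p = q.
Proof.
  destruct p as [a b c], q as [a' b' c']; intros H.
  apply pair_inj in H as [H E]; cbn in H, E; subst c'.
  apply pair_inj in H as [E E']; now subst.
Qed.

(** Three number quantifiers instead of one over [rat] keep this convertible with the meaning of
    [decode]. *)
Definition decodes (t : num) (P : rat -> Prop) : Prop :=
  exists a b c, t = rcode (Rat a b c) /\ 0 < c /\ P (Rat a b c).

Lemma decodes_iff t P : decodes t P <-> exists p, t = rcode p /\ 0 < rden p /\ P p.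
Proof.
  split; [intros (a & b & c & H); now exists (Rat a b c)|].
  intros [[a b c] H]; now exists a, b, c.
Qed.

Lemma decodes_rcode p P : 0 < rden p -> (decodes (rcode p) P <-> P p).
Proof.
  intros Hp; rewrite decodes_iff; split; [|intros H; now exists p].
  intros (q & E & _ & H); apply rcode_inj in E; now subst q.
Qed.

Lemma rle_add_r p q : rneg q = 0 -> rle p (radd p q).
Proof.
  destruct p as [a b c], q as [a' b' c']; unfold rle; cbn; intros ->.
  apply le_intro with (a' * c * c); ring.
Qed.

Lemma rlt_add_r p q : rneg q = 0 -> 0 < rpos q -> 0 < rden p -> rlt p (radd p q).
Proof.
  destruct p as [a b c], q as [a' b' c']; unfold rlt; cbn; intros -> H H'.
  destruct (pos_succ (mul_pos H (mul_pos H' H'))) as [z Hz].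
  apply lt_intro with z.
  transitivity (a * (c * c') + (b * c' + 0 * c) * c + a' * (c * c)); [ring|].
  rewrite Hz; ring.
Qed.

Lemma rle_rlt_trans p q r : 0 < rden p -> 0 < rden q -> 0 < rden r ->
  rle p q -> rlt q r -> rlt p r.
Proof.
  destruct p as [a b c], q as [a' b' c'], r as [a'' b'' c'']; unfold rle, rlt; cbn.
  (* The inequalities, multiplied by the outer denominators, are added; the numerators of [q]
     cancel, and so does its denominator. *)
  intros Hc Hc' Hc'' H H'; apply (mul_lt_inv (z := c')).
  apply (add_lt_inv (z := b' * c * c'' + a' * c * c'')).
  eapply le_lt_trans; [|eapply lt_le_trans;
    [apply add_lt_le; [exact (mul_lt_l Hc H')|exact (mul_le H (le_refl c''))]|]].
  - right; ring.
  - right; ring.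
Qed.

Lemma rlt_of_add p q r : rneg r = 0 -> 0 < rden p -> 0 < rden q -> 0 < rden r ->
  rlt (radd p r) q -> rlt p q.
Proof.
  intros E Hp Hq Hr H; eapply rle_rlt_trans; [| | | |exact H]; auto.
  - now apply mul_pos.
  - now apply rle_add_r.
Qed.

(** Fractions with denominators d and d' that differ are at least 1/(dd') apart, so c/2^n fits in
    between as soon as 2^n exceeds cdd'. *)
Lemma rlt_gap c p q : 0 < rden p -> 0 < rden q -> rlt p q ->
  exists m, forall n, m <= n -> rlt (radd p (Rat c 0 (pow2 n))) q.
Proof.
  destruct p as [a b d], q as [a' b' d']; unfold rlt; cbn; intros Hd Hd' H.
  exists (c * (d * d')); intros n Hn.
  pose proof (le_lt_trans Hn (lt_pow2 n)) as Hn'.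
  destruct (lt_exists Hn') as [y Hy], (lt_exists H) as [z Hz].
  apply lt_intro with (z * pow2 n + y).
  transitivity ((a' * d + b * d') * pow2 n); [ring|]; rewrite Hz.
  transitivity ((a * d' + b' * d + z) * pow2 n + (c * (d * d') + y + 1));
    [rewrite <- Hy|]; ring.
Qed.

Definition cst (t : num) : car M ty1 := ap (mPi M N N) t.

Lemma ap_cst t n : ap (cst t) n = t.
Proof. apply ap_Pi. Qed.

(** This and the following relations are shaped so as to be convertible with the satisfaction of the
    corresponding formulas. *)
Definition is_real_m (x : car M ty1) : Prop := forall n i,
  decodes (ap x n) (fun p => decodes (ap x (n + i)) (fun q =>
    rlt p (radd q (rpow n)) /\ rlt q (radd p (rpow n)))).

Definition Req (x y : car M ty1) : Prop := forall n,
  decodes (ap x n) (fun p => decodes (ap y n) (fun q =>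
    rle p (radd q (rpow' n)) /\ rle q (radd p (rpow' n)))).

Definition Rle (x y : car M ty1) : Prop := forall n,
  decodes (ap x n) (fun p => decodes (ap y n) (fun q => rle p (radd q (rpow' n)))).

Definition Rlt (x y : car M ty1) : Prop := exists n,
  decodes (ap x n) (fun p => decodes (ap y n) (fun q => rlt (radd p (rpow' n)) q)).

Definition Rle_add (x y z : car M ty1) : Prop := forall n,
  decodes (ap x n) (fun p => decodes (ap y (n + 1)) (fun q =>
    decodes (ap z (n + 1)) (fun r => rle p (radd (radd q r) (rpow' n))))).

Lemma rpow_add_r p n : 0 < rden p -> rlt p (radd p (rpow n)).
Proof. intros H; apply rlt_add_r; [reflexivity|apply lt_0_1|exact H]. Qed.

Lemma is_real_cst p : 0 < rden p -> is_real_m (cst (rcode p)).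
Proof.
  intros H n i; rewrite !ap_cst, !decodes_rcode by exact H.
  split; now apply rpow_add_r.
Qed.

Lemma Req_cst p : 0 < rden p -> Req (cst (rcode p)) (cst (rcode p)).
Proof.
  intros H n; rewrite !ap_cst, !decodes_rcode by exact H.
  split; now apply rle_add_r.
Qed.

Lemma Rlt_cst p q : 0 < rden p -> 0 < rden q ->
  (Rlt (cst (rcode p)) (cst (rcode q)) <-> rlt p q).
Proof.
  intros Hp Hq; split.
  - intros [n H]; rewrite !ap_cst, !decodes_rcode in H by assumption.
    apply (rlt_of_add (r := rpow' n)); auto; apply pow2_pos.
  - intros H; destruct (rlt_gap (1 + 1) Hp Hq H) as [n Hn]; exists n.
    rewrite !ap_cst, !decodes_rcode by assumption; apply Hn, le_refl.
Qed.

(** Quantifier-free choice decides the matrix as a functional of a single sequence that codes both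
    numbers. For fixed n, mu finds a candidate i, and testing the matrix at that i settles the
    existential statement. *)
Lemma sigma1_comprehension G (p : form (N :: N :: G)) (e : env M G) : qf p ->
  exists X : car M ty1, forall n, (ap X n = 0 \/ ap X n = 1)
    /\ (ap X n = 1 <-> exists i, sat p (econs i (econs n e))).
Proof.
  intros Hp.
  (* The sequence carries n at argument 0 and i at argument 1. *)
  set (f := scons (App (Var vz) One) (scons (App (Var vz) Zero) (fun s v => Var (vs v)))
    : sub (N :: N :: G) (ty1 :: G)).
  set (p' := sub_form p f).
  destruct (qf_characteristic (p := p') e (qf_sub _ Hp)) as [X HX].
  set (h i n := seq_cons_m n (cst i)).
  assert (HX' : forall i n, sat p (econs i (econs n e)) /\ ap X (h i n) = 1
    \/ ~ sat p (econs i (econs n e)) /\ ap X (h i n) = 0).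
  { intros i n.
    assert (E : sat p' (econs (h i n) e) <-> sat p (econs i (econs n e))).
    { unfold p'; rewrite sat_sub.
      assert (E : (fun s v => eval (f s v) (econs (h i n) e))
        = econs i (econs n e)); [|now rewrite E].
      apply family_ext; apply var_cons_ind; [|apply var_cons_ind; [apply ap_Rec_0|reflexivity]].
      change (ap (h i n) 1 = i); replace 1 with (0 + 1) by ring.
      unfold h; now rewrite seq_cons_S, ap_cst. }
    rewrite <- E; apply HX. }
  destruct (HM (nil_env M) (ACA0w_IND_base (ACA0w_mu2 []))) as [mu Hmu].
  set (seq' := fun G (n : term G N) (i : term G N) => seq_cons n (App (Pi N N) i)).
  (* Recursion with base 1 and step constantly 0 exchanges the truth values, because mu searches for
     zeros. *)
  exists (eval (lam (App (Var (vs vz)) (seq' _ (Var vz) (App (Var (vs (vs vz)))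
    (lam (App (App (App Rec (App (Pi _ _) (App (Pi _ _) Zero))) One)
      (App (Var (vs (vs vz))) (seq' _ (Var (vs vz)) (Var vz)))))))))
    (econs X (econs mu (nil_env M)))).
  intros n; rewrite eval_lam.
  match goal with |- context [eval (App ?a (seq' ?G ?b (App ?c ?d))) ?e] =>
    set (g := eval d e) end.
  change ((ap X (h (ap mu g) n) = 0 \/ ap X (h (ap mu g) n) = 1)
    /\ (ap X (h (ap mu g) n) = 1 <-> exists i, sat p (econs i (econs n e)))).
  assert (Hg : forall i, ap g i = 0 <-> sat p (econs i (econs n e))).
  { intros i; unfold g; rewrite eval_lam.
    change (ap (ap (ap (mRec M) (ap (mPi M _ _) (ap (mPi M _ _) 0))) 1) (ap X (h i n)) = 0
      <-> sat p (econs i (econs n e))).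
    destruct (HX' i n) as [[H E]|[H E]]; rewrite E.
    - split; auto; intros _; replace 1 with (0 + 1) at 2 by ring.
      now rewrite ap_Rec_S, !ap_Pi.
    - rewrite ap_Rec_0; split; [|easy].
      intros E'; destruct (lt_irrefl (x := 0)); rewrite <- E' at 2; apply lt_0_1. }
  destruct (HX' (ap mu g) n) as [[H E]|[H E]]; rewrite E; split; auto.
  - split; [intros _; now exists (ap mu g)|auto].
  - split; [intros E'; destruct (lt_irrefl (x := 0)); rewrite E' at 2; apply lt_0_1|].
    intros [i Hi]; destruct H; apply Hg.
    apply (proj1 (Hmu g)); exists i; now apply Hg.
Qed.

(** * The metric space *)

Definition val (f : car M ty1) : num := ap f 0.

Definition tl (f : car M ty1) : car M ty1 :=
  eval (lam (App (Var (vs vz)) (App (App Plus (Var vz)) One))) (econs f (nil_env M)).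

Lemma ap_tl f k : ap (tl f) k = ap f (k + 1).
Proof. apply eval_lam. Qed.

Lemma seq_cons_tl n f : tl (seq_cons_m n f) = f.
Proof. apply ap_ext; intros k; now rewrite ap_tl, seq_cons_S. Qed.

(** Definition by cases on zero or successor: recursion whose step ignores both its arguments. *)
Definition case (a b z : num) : num :=
  ap (ap (ap (mRec M) (ap (mPi M (N ⟶ N) N) (ap (mPi M N N) b))) a) z.

Lemma case_0 a b : case a b 0 = a.
Proof. apply ap_Rec_0. Qed.

Lemma case_S a b z : case a b (z + 1) = b.
Proof. unfold case; now rewrite ap_Rec_S, !ap_Pi. Qed.

Lemma case_1 a b : case a b 1 = b.
Proof. replace 1 with (0 + 1) by ring; apply case_S. Qed.

Lemma zero_neq_one : 0 <> 1.
Proof. intros H; destruct (lt_irrefl (x := 0)); rewrite H at 2; apply lt_0_1. Qed.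

(** Choice provides functionals on sequences only, so the two numbers are packed into one sequence
    and compared at its arguments 0 and 1. *)
Lemma eq_characteristic : exists F : car M (N ⟶ N ⟶ N)%ty, forall a b,
  a = b /\ ap (ap F a) b = 1 \/ a <> b /\ ap (ap F a) b = 0.
Proof.
  destruct (qf_characteristic
    (p := Eq (App (Var vz) Zero) (App (Var vz) One)) (nil_env M) I) as [X HX].
  exists (eval (lam (lam (App (Var (vs (vs vz)))
    (seq_cons (Var (vs vz)) (App (Pi N N) (Var vz)))))) (econs X (nil_env M))).
  intros a b; rewrite !eval_lam.
  change (a = b /\ ap X (seq_cons_m a (cst b)) = 1
    \/ a <> b /\ ap X (seq_cons_m a (cst b)) = 0).
  assert (E0 : ap (seq_cons_m a (cst b)) 0 = a) by apply seq_cons_0.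
  assert (E1 : ap (seq_cons_m a (cst b)) 1 = b).
  { replace 1 with (0 + 1) by ring; now rewrite seq_cons_S, ap_cst. }
  set (h := seq_cons_m a (cst b)) in *; specialize (HX h).
  change (ap h 0 = ap h 1 /\ ap X h = 1 \/ ap h 0 <> ap h 1 /\ ap X h = 0) in HX.
  now rewrite E0, E1 in HX.
Qed.

(** The point with value [0] is the limit of the points of value [n + 1]. *)
Definition weight (a : num) : rat := Rat (case 0 1 a) 0 (pow2 a).

(** The distinction is made outside the model; [space_dist_exists] provides the functional of the
    model that computes the codes. *)
Definition dist (a b : num) : rat :=
  if excluded_middle_informative (a = b) then rat0 else radd (weight a) (weight b).

Lemma dist_refl a : dist a a = rat0.
Proof. unfold dist; now destruct excluded_middle_informative. Qed.

Lemma dist_neq a b : a <> b -> dist a b = radd (weight a) (weight b).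
Proof. intros H; unfold dist; now destruct excluded_middle_informative. Qed.

Lemma dist_sym a b : dist a b = dist b a.
Proof.
  unfold dist; destruct excluded_middle_informative, excluded_middle_informative;
    try congruence; unfold radd; f_equal; cbn; ring.
Qed.

Lemma dist_den a b : 0 < rden (dist a b).
Proof.
  unfold dist; destruct excluded_middle_informative; [apply lt_0_1|].
  apply mul_pos; apply pow2_pos.
Qed.

Lemma dist_neg a b : rneg (dist a b) = 0.
Proof. unfold dist; destruct excluded_middle_informative; [reflexivity|cbn; ring]. Qed.

Lemma weight_pos a : a <> 0 -> rpos (weight a) = 1.
Proof.
  destruct (zero_or_succ a) as [|[b ->]]; [easy|intros _]; apply case_S.
Qed.

Lemma dist_pos a b : a <> b -> rlt rat0 (dist a b).
Proof.
  revert a b.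
  assert (H : forall a b, a <> b -> a <> 0 -> rlt rat0 (dist a b)).
  { intros a b H Ha; rewrite dist_neq by exact H.
    unfold rlt; cbn; fold (weight a); change (case 0 1 a) with (rpos (weight a)).
    rewrite weight_pos by exact Ha; destruct (pos_succ (pow2_pos b)) as [z ->].
    apply lt_intro with (z + case 0 1 b * pow2 a); ring. }
  intros a b Hn; destruct (classic (a = 0)) as [->|Ha]; [|now apply H].
  rewrite dist_sym; apply H; congruence.
Qed.

Lemma rle_0 p : rneg p = 0 -> rle rat0 p.
Proof.
  destruct p as [a b c]; unfold rle; cbn; intros ->; apply le_intro with a; ring.
Qed.

Lemma dist_triangle a b c n :
  rle (dist a b) (radd (radd (dist a c) (dist c b)) (rpow' n)).
Proof.
  assert (Hr : forall p q, rneg p = 0 -> rle q (radd (radd q p) (rpow' n))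
    /\ rle q (radd (radd p q) (rpow' n))).
  { intros [x y z] [x' y' z']; unfold rle; cbn; intros ->; split;
      apply le_intro with (x * z' * z' * pow2 n + (1 + 1) * z * z' * z'); ring. }
  destruct (classic (a = b)) as [->|Hab].
  { rewrite dist_refl; apply rle_0; cbn; rewrite !dist_neg; ring. }
  destruct (classic (a = c)) as [->|Hac]; [apply Hr, dist_neg|].
  destruct (classic (c = b)) as [->|Hcb]; [apply Hr, dist_neg|].
  rewrite (dist_neq Hab), (dist_neq Hac), (dist_neq Hcb).
  unfold rle, radd; cbn.
  set (A := pow2 a); set (B := pow2 b); set (C := pow2 c); set (Q := pow2 n).
  (* The two summands of the surplus stem from twice the weight of c and from the error term. *)
  apply le_intro with ((1 + 1) * case 0 1 c * A * C * B * A * B * Q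
    + (1 + 1) * A * C * C * B * A * B); ring.
Qed.

Lemma pred_exists : exists P : car M (N ⟶ N)%ty, forall n, ap P (n + 1) = n.
Proof.
  exists (eval (App (App Rec (Pi N N)) Zero) (nil_env M) : car M (N ⟶ N)%ty).
  intros n; etransitivity; [apply ap_Rec_S|apply ap_Pi].
Qed.

Lemma tl_exists : exists F : car M (ty1 ⟶ ty1)%ty, forall f, ap F f = tl f.
Proof.
  exists (eval (lam (lam (App (Var (vs vz)) (App (App Plus (Var vz)) One)))) (nil_env M)).
  intros f; rewrite eval_lam; apply ap_ext; intros k; rewrite ap_tl; apply eval_lam.
Qed.

(** Replacing n by the predecessor of f(0) makes membership quantifier-free; the first disjunct
    takes care of f(0) = 0. *)
Lemma space_points_exist (Y : car M ty2) : exists D : car M ty2, forall f,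
  (ap D f = 0 \/ ap D f = 1)
  /\ (ap D f = 1 <-> val f = 0
        \/ exists n, val f = n + 1 /\ ap Y (seq_cons_m n (tl f)) = 0).
Proof.
  destruct pred_exists as [P HP], tl_exists as [F HF].
  destruct (qf_characteristic (p := (Var vz @ 0 = 0
      \/ Var (vs vz) @ seq_cons (Var (vs (vs vz)) @ (Var vz @ 0))
           (Var (vs (vs (vs vz))) @ Var vz) = 0)%form)
    (econs Y (econs P (econs F (nil_env M)))) (conj I I)) as [D HD].
  exists D; intros f; specialize (HD f).
  change ((val f = 0 \/ ap Y (seq_cons_m (ap P (val f)) (ap F f)) = 0) /\ ap D f = 1
    \/ ~ (val f = 0 \/ ap Y (seq_cons_m (ap P (val f)) (ap F f)) = 0) /\ ap D f = 0) in HD.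
  rewrite HF in HD.
  assert (E : (val f = 0 \/ ap Y (seq_cons_m (ap P (val f)) (tl f)) = 0)
    <-> (val f = 0 \/ exists n, val f = n + 1 /\ ap Y (seq_cons_m n (tl f)) = 0)).
  { destruct (zero_or_succ (val f)) as [->|[n Hn]]; [tauto|].
    rewrite Hn, HP; split; intros [H|H]; auto; right.
    - now exists n.
    - destruct H as [n' [H1 H2]]; apply add_cancel in H1; now subst. }
  rewrite E in HD; destruct HD as [[H H']|[H H']]; split; auto.
  - tauto.
  - rewrite H'; split; [intros K; now destruct zero_neq_one|tauto].
Qed.

Lemma space_eq_exists : exists E : car M (ty1 ⟶ ty1 ⟶ N)%ty, forall e f,
  (ap (ap E e) f = 0 \/ ap (ap E e) f = 1) /\ (ap (ap E e) f = 1 <-> val e = val f).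
Proof.
  destruct eq_characteristic as [F HF].
  exists (eval (lam (lam (App (App (Var (vs (vs vz)))
    (App (Var (vs vz)) Zero)) (App (Var vz) Zero)))) (econs F (nil_env M))).
  intros e f; rewrite !eval_lam.
  change ((ap (ap F (val e)) (val f) = 0 \/ ap (ap F (val e)) (val f) = 1)
    /\ (ap (ap F (val e)) (val f) = 1 <-> val e = val f)).
  destruct (HF (val e) (val f)) as [[H ->]|[H ->]]; split; auto; [tauto|].
  split; [intros K; now destruct zero_neq_one|easy].
Qed.

Lemma space_dist_exists : exists d : car M (ty1 ⟶ ty1 ⟶ ty1)%ty, forall e f,
  ap (ap d e) f = cst (rcode (dist (val e) (val f))).
Proof.
  destruct eq_characteristic as [F HF].
  pose (tcase := fun G (a b z : term G N) =>
    App (App (App Rec (App (Pi (N ⟶ N) N) (App (Pi N N) b))) a) z).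
  pose (w := fun G (f : term G ty1) =>
    Frac (tcase G Zero One (App f Zero)) Zero (exp2 (App f Zero))).
  exists (eval (lam (lam (real_of_rat (tcase _
    (code (fadd (w _ (Var (vs vz))) (w _ (Var vz))))
    (code (Frac Zero Zero One))
    (App (App (Var (vs (vs vz))) (App (Var (vs vz)) Zero)) (App (Var vz) Zero))))))
    (econs F (nil_env M))).
  intros e f; rewrite !eval_lam.
  change (cst (case (rcode (radd (weight (val e)) (weight (val f)))) (rcode rat0)
    (ap (ap F (val e)) (val f))) = cst (rcode (dist (val e) (val f)))).
  f_equal; destruct (HF (val e) (val f)) as [[H ->]|[H ->]].
  - now rewrite H, dist_refl, case_1.
  - now rewrite case_0, dist_neq.
Qed.

(** * Completeness, compactness and nets of the space *)

Section Space.
Context (Y D : car M ty2) (E : car M (ty1 ⟶ ty1 ⟶ N)%ty) (d : car M (ty1 ⟶ ty1 ⟶ ty1)%ty)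
  (D_set : forall f, ap D f = 0 \/ ap D f = 1)
  (D_spec : forall f, ap D f = 1 <-> val f = 0
     \/ exists n, val f = n + 1 /\ ap Y (seq_cons_m n (tl f)) = 0)
  (E_rel : forall e f, ap (ap E e) f = 0 \/ ap (ap E e) f = 1)
  (E_spec : forall e f, ap (ap E e) f = 1 <-> val e = val f)
  (d_spec : forall e f, ap (ap d e) f = cst (rcode (dist (val e) (val f)))).

Definition space_env : env M [(ty1 ⟶ ty1 ⟶ ty1)%ty; (ty1 ⟶ ty1 ⟶ N)%ty; ty2] :=
  econs d (econs E (econs D (nil_env M))).

Definition pt : car M ty1 := cst 0.

Lemma val_pt : val pt = 0.
Proof. apply ap_cst. Qed.

Lemma pt_in : ap D pt = 1.
Proof. apply D_spec; left; apply val_pt. Qed.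

Lemma d_val e e' f f' : val e = val e' -> val f = val f' ->
  ap (ap d e) f = ap (ap d e') f'.
Proof. intros H H'; now rewrite !d_spec, H, H'. Qed.

Definition rpowR (k : num) : car M ty1 := cst (rcode (rpow k)).

Lemma d_refl_lt e f k : val e = val f -> Rlt (ap (ap d e) f) (rpowR k).
Proof.
  intros H; rewrite d_spec, H, dist_refl.
  apply Rlt_cst; [apply lt_0_1|apply pow2_pos|].
  unfold rlt; cbn; apply lt_intro with 0; ring.
Qed.

(** If [f] has value [a], then [d(f, x) <= d(pt, x) + 2^(-a)]. *)
Lemma near x y : Rlt (ap (ap d pt) x) y ->
  exists m, forall f, m <= val f -> Rlt (ap (ap d f) x) y.
Proof.
  intros [n H]; rewrite d_spec, val_pt, ap_cst, decodes_rcode in H by apply dist_den.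
  rewrite decodes_iff in H; destruct H as (q & Eq & Hq & H).
  pose proof (dist_den 0 (val x)) as Hd.
  assert (Hp : 0 < rden (radd (dist 0 (val x)) (rpow' n)))
    by (apply mul_pos; [exact Hd|apply pow2_pos]).
  destruct (rlt_gap 1 Hp Hq H) as [m Hm].
  (* The summand [m] makes 2^(-a) fit into the gap; [val x + 1] makes [f] differ from [x] and from
     the limit point, so that the distance is a sum of weights. *)
  exists (m + val x + 1); intros f Hf; exists n.
  rewrite d_spec, ap_cst, decodes_rcode by apply dist_den.
  rewrite decodes_iff; exists q; split; [exact Eq|split; [exact Hq|]].
  assert (Hx : val x < val f).
  { eapply lt_le_trans; [|exact Hf]; apply lt_intro with m; ring. }
  assert (Hf0 : val f <> 0).
  { intros K; rewrite K in Hx; apply (lt_not_le Hx), le_0_l. }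
  refine (rle_rlt_trans _ _ _ _ (Hm (val f) _)).
  - apply mul_pos; [apply dist_den|apply pow2_pos].
  - apply mul_pos; [exact Hp|apply pow2_pos].
  - exact Hq.
  - rewrite (dist_neq (a := val f)) by (intros K; rewrite K in Hx; now apply lt_irrefl in Hx).
    unfold rle, radd; cbn -[dist].
    change (case 0 1 (val f)) with (rpos (weight (val f))); rewrite (weight_pos Hf0).
    destruct (classic (val x = 0)) as [->|Hx0].
    + rewrite dist_refl; cbn; rewrite case_0, pow2_0; right; ring.
    + rewrite dist_neq by auto; cbn; rewrite case_0, pow2_0; right; ring.
  - eapply le_trans; [|exact Hf]; apply le_intro with (val x + 1); ring.
Qed.

Definition conv (x : car M (N ⟶ ty1)%ty) (y : car M ty1) : Prop :=
  forall k, exists m, forall i, m <= i -> Rlt (ap (ap d (ap x i)) y) (rpowR k).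

(** If no value recurs cofinally, each value is eventually avoided; by induction on k, so are all
    values below k. *)
Lemma values_dichotomy (x : car M (N ⟶ ty1)%ty) :
  (exists v, forall m, exists n, m <= n /\ val (ap x n) = v)
  \/ (forall k, exists m, forall n, m <= n -> k <= val (ap x n)).
Proof.
  destruct (classic (exists v, forall m, exists n, m <= n /\ val (ap x n) = v))
    as [H|H]; [now left|right].
  refine (model_ind (p := (EX m : N, ALL n : N,
      ↑m <= n ==> Var (vs (vs vz)) <= Var (vs (vs (vs vz))) @ n @ 0)%form)
    (e := econs x (nil_env M)) _ _).
  - exists 0; intros n _; apply le_0_l.
  - intros k [m Hm]; change (forall n, m <= n -> k <= val (ap x n)) in Hm.
    assert (H' : exists m', forall n, m' <= n -> val (ap x n) <> k).
    { apply NNPP; intros H'; apply H; exists k; intros m'.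
      apply NNPP; intros H''; apply H'; exists m'; intros n Hn K.
      apply H''; now exists n. }
    destruct H' as [m' Hm']; exists (m + m'); intros n Hn.
    change (m + m' <= n) in Hn; change (k + 1 <= val (ap x n)).
    assert (H1 : m <= n) by (eapply le_trans; [apply le_add_r|exact Hn]).
    assert (H2 : m' <= n).
    { eapply le_trans; [apply le_add_r|rewrite add_comm; exact Hn]. }
    specialize (Hm n H1); specialize (Hm' n H2).
    destruct Hm as [Hm|Hm]; [|congruence].
    destruct (lt_exists Hm) as [z Hz]; apply le_intro with z; rewrite Hz; ring.
Qed.

(** A ball around the limit point contains all points of sufficiently large value. *)
Lemma escape_conv x : (forall k, exists m, forall n, m <= n -> k <= val (ap x n)) ->
  conv x pt.
Proof.
  intros H k; destruct (near (d_refl_lt k (eq_refl (val pt)))) as [k' Hk'].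
  destruct (H k') as [m Hm]; exists m; intros i Hi; now apply Hk', Hm.
Qed.

Lemma space_complete (x : car M (N ⟶ ty1)%ty) :
  (forall n, ap D (ap x n) = 1) ->
  (forall k, exists m, forall i j, m <= i -> m <= j ->
    Rlt (ap (ap d (ap x i)) (ap x j)) (rpowR k)) ->
  exists y, ap D y = 1 /\ conv x y.
Proof.
  intros Hx Hc; destruct (values_dichotomy x) as [[v Hv]|H];
    [|exists pt; split; [apply pt_in|now apply escape_conv]].
  destruct (Hv 0) as [n0 [_ H0]]; exists (ap x n0); split; [apply Hx|].
  intros k; destruct (Hc k) as [m Hm]; exists m; intros i Hi.
  (* Distances depend on values only, so the limit may be replaced by a later term of the same
     value, to which the Cauchy condition applies. *)
  destruct (Hv m) as [n [Hn Hnv]].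
  rewrite (d_val (e' := ap x i) (f' := ap x n)); [now apply Hm|easy|congruence].
Qed.

Lemma space_sequentially_compact (x : car M (N ⟶ ty1)%ty) :
  (forall n, ap D (ap x n) = 1) ->
  exists g : car M ty1, (forall n, ap g n < ap g (n + 1))
    /\ exists y, ap D y = 1
      /\ conv (ap (ap (mSigma M N N ty1) (ap (mPi M _ N) x)) g) y.
Proof.
  intros Hx; destruct (values_dichotomy x) as [[v Hv]|H].
  (* Choice takes a sequence as input, so the last index is passed as f(0); the result is a larger
     index at which the recurring value [v] is taken. *)
  - destruct (qf_choice
      (p := (Var (vs vz) @ 0 + 1 <= Var vz
        /\ Var (vs (vs vz)) @ Var vz @ 0 = Var (vs (vs (vs vz))))%form)
      (e := econs x (econs v (nil_env M)))) as [G HG].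
    { cbn; auto. }
    { intros f; exact (Hv (val f + 1)). }
    change (forall f, val f + 1 <= ap G f /\ val (ap x (ap G f)) = v) in HG.
    (* Iterating the choice functional by recursion enumerates indices of value [v] increasingly. *)
    set (g := eval (App (App Rec (lam (lam (App (Var (vs (vs vz))) (App (Pi N N) (Var vz))))))
      (App (Var vz) (App (Pi N N) Zero))) (econs G (nil_env M)) : car M ty1).
    assert (g0 : ap g 0 = ap G (cst 0)) by apply ap_Rec_0.
    assert (gS : forall n, ap g (n + 1) = ap G (cst (ap g n))).
    { intros n; etransitivity; [apply ap_Rec_S|]; now rewrite !eval_lam. }
    assert (gv : forall n, val (ap x (ap g n)) = v).
    { intros n; destruct (zero_or_succ n) as [->|[n' ->]]; [rewrite g0|rewrite gS];
        apply HG. }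
    exists g; split.
    + intros n; rewrite gS; eapply lt_le_trans; [|apply HG].
      unfold val; rewrite ap_cst; apply lt_add_1.
    + exists (ap x (ap g 0)); split; [apply Hx|].
      intros k; exists 0; intros i _; rewrite ap_Sigma, ap_Pi; apply d_refl_lt.
      now rewrite !gv.
  (* When the values escape, the whole sequence converges, and the identity selects it. *)
  - exists (eval (lam (Var vz)) (nil_env M)); split.
    + intros n; rewrite !eval_lam; apply lt_add_1.
    + exists pt; split; [apply pt_in|]; apply escape_conv; intros k.
      destruct (H k) as [m Hm]; exists m; intros n Hn.
      rewrite ap_Sigma, ap_Pi, eval_lam; now apply Hm.
Qed.

(** Recursion yields numbers only, so the case distinction between two sequences is made at each
    argument k. *)
Lemma patch_exists (e : car M (N ⟶ ty1)%ty) (n : num) (f : car M ty1) :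
  exists e' : car M (N ⟶ ty1)%ty, forall i,
    i = n /\ ap e' i = f \/ i <> n /\ ap e' i = ap e i.
Proof.
  destruct eq_characteristic as [F HF].
  exists (eval (lam (lam (App (App (App Rec (App (Pi (N ⟶ N) N) (App (Pi N N)
      (App (Var (vs (vs (vs (vs vz))))) (Var vz)))))
      (App (App (Var (vs (vs vz))) (Var (vs vz))) (Var vz)))
      (App (App (Var (vs (vs (vs vz)))) (Var (vs vz))) (Var (vs (vs (vs (vs (vs vz))))))))))
    (econs e (econs F (econs f (econs n (nil_env M)))))).
  intros i; destruct (HF i n) as [[Hi E']|[Hi E']]; [left|right]; split; auto;
    apply ap_ext; intros k; rewrite !eval_lam.
  - change (case (ap (ap e i) k) (ap f k) (ap (ap F i) n) = ap f k).
    now rewrite E', case_1.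
  - change (case (ap (ap e i) k) (ap f k) (ap (ap F i) n) = ap (ap e i) k).
    now rewrite E', case_0.
Qed.

(** Finitely many points are chosen by full induction on n, the existence of the list being part of
    the induction formula. Values that do not occur leave the entry at its old point. *)
Lemma points_below n : exists e : car M (N ⟶ ty1)%ty,
  (forall i, ap D (ap e i) = 1) /\ ap e 0 = pt
  /\ forall i f, i < n -> ap D f = 1 -> val f = i -> val (ap e i) = i.
Proof.
  assert (H : exists e : car M (N ⟶ ty1)%ty,
    (forall i, ap D (ap e i) = 1) /\ (forall k, ap (ap e 0) k = 0)
    /\ forall i f, i < n -> ap D f = 1 -> val f = i -> val (ap e i) = i);
    [|destruct H as (e & H1 & H2 & H3); exists e; split; [easy|split; [|easy]];
      apply ap_ext; intros k; rewrite H2; symmetry; apply ap_cst].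
  (* Atomic formulas compare numbers only, so entry 0 being the limit point is expressed
     pointwise. *)
  refine (model_ind (p := (EX e : (N ⟶ ty1), 
     (ALL i : N, Var (vs (vs (vs vz))) @ (↑e @ i) = 1)
     /\ (ALL k : N, ↑e @ 0 @ k = 0)
     /\ ALL i : N, ALL f : ty1, ↑i < Var (vs (vs (vs vz))) ==>
          Var (vs (vs (vs (vs vz)))) @ f = 1 ==> f @ 0 = ↑i ==> ↑e @ ↑i @ 0 = ↑i)%form)
    (e := econs D (nil_env M)) _ _ n); clear n.
  - exists (ap (mPi M ty1 N) pt); split; [|split].
    + intros i; change (ap D (ap (ap (mPi M ty1 N) pt) i) = 1); rewrite ap_Pi; apply pt_in.
    + intros k; change (ap (ap (ap (mPi M ty1 N) pt) 0) k = 0); rewrite ap_Pi; apply ap_cst.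
    + intros i f H; destruct (lt_not_le H (le_0_l i)).
  - intros n (e & H1 & H2 & H3).
    change (forall i, ap D (ap e i) = 1) in H1.
    change (forall k, ap (ap e 0) k = 0) in H2.
    change (forall i f, i < n -> ap D f = 1 -> val f = i -> val (ap e i) = i) in H3.
    change (exists e : car M (N ⟶ ty1)%ty,
      (forall i, ap D (ap e i) = 1) /\ (forall k, ap (ap e 0) k = 0)
      /\ forall i f, i < n + 1 -> ap D f = 1 -> val f = i -> val (ap e i) = i).
    (* Position 0 is never overwritten, so it keeps the limit point. *)
    destruct (classic (n <> 0 /\ exists f, ap D f = 1 /\ val f = n)) as [[Hn [f [Hf Hfn]]]|H].
    + destruct (patch_exists e n f) as [e' He']; exists e'; split; [|split].
      * intros i; destruct (He' i) as [[_ ->]|[_ ->]]; auto.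
      * destruct (He' 0) as [[K _]|[_ ->]]; [now symmetry in K|exact H2].
      * intros i g Hi Hg Hgi; destruct (He' i) as [[-> ->]|[K ->]]; [easy|].
        apply lt_succ in Hi as [Hi|]; [eauto|easy].
    + exists e; split; [easy|split; [easy|]]; intros i g Hi Hg Hgi.
      apply lt_succ in Hi as [Hi| ->]; [eauto|].
      destruct (classic (n = 0)) as [->|Hn]; [apply H2|].
      destruct H; split; [easy|now exists g].
Qed.

Lemma space_heine_borel (R : car M (ty1 ⟶ ty1)%ty) :
  (forall e, ap D e = 1 -> Rlt (cst (rcode rat0)) (ap R e)) ->
  exists (k : num) (e : car M (N ⟶ ty1)%ty), (forall i, i < k -> ap D (ap e i) = 1)
    /\ forall f, ap D f = 1 ->
         exists i, i < k /\ Rlt (ap (ap d f) (ap e i)) (ap R (ap e i)).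
Proof.
  intros HR.
  assert (HR' : forall e f, ap D e = 1 -> val f = val e -> Rlt (ap (ap d f) e) (ap R e)).
  { intros e f He H; rewrite d_spec, H, dist_refl; now apply HR. }
  destruct (near (HR' pt pt pt_in eq_refl)) as [n Hn].
  destruct (points_below n) as (e & He & He0 & Hen).
  (* The length n + 1 keeps index 0, the limit point, in range even for n = 0. *)
  exists (n + 1), e; split; [auto|]; intros f Hf.
  destruct (lt_or_le (val f) n) as [H|H].
  - exists (val f); split; [apply lt_succ; now left|].
    apply HR'; [easy|]; symmetry; now apply (Hen (val f) f).
  - exists 0; split; [apply lt_succ, le_0_l|]; rewrite He0; now apply Hn.
Qed.

Lemma space_countable_heine_borel (x : car M (N ⟶ ty1)%ty) (r : car M ty1) :
  (forall f, ap D f = 1 -> exists n, Rlt (ap (ap d f) (ap x n)) (cst (ap r n))) ->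
  exists k, forall f, ap D f = 1 ->
    exists n, n < k /\ Rlt (ap (ap d f) (ap x n)) (cst (ap r n)).
Proof.
  intros H.
  assert (Hb : forall b, exists k, forall f, ap D f = 1 -> val f < b ->
    exists n, n < k /\ Rlt (ap (ap d f) (ap x n)) (cst (ap r n))).
  (* Each value needs only one covering index, so induction on the bound [b] collects finitely many
     of them. *)
  { refine (model_ind (p := (EX k : N, ALL f : ty1,
        Var (vs (vs (vs (vs (vs (vs vz)))))) @ f = 1 ==> f @ 0 < Var (vs (vs vz)) ==>
        EX n : N, n < ↑k
          /\ real_lt (Var (vs (vs (vs (vs vz)))) @ ↑f @ (Var (vs (vs (vs (vs (vs vz))))) @ n))
               (real_of_rat (Var (vs (vs (vs (vs (vs (vs vz)))))) @ n)))%form)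
      (e := econs d (econs x (econs r (econs D (nil_env M))))) _ _).
    - exists 0; intros f _ Hf; destruct (lt_not_le Hf (le_0_l _)).
    - intros b [k Hk].
      change (forall f, ap D f = 1 -> val f < b ->
        exists n, n < k /\ Rlt (ap (ap d f) (ap x n)) (cst (ap r n))) in Hk.
      change (exists k, forall f, ap D f = 1 -> val f < b + 1 ->
        exists n, n < k /\ Rlt (ap (ap d f) (ap x n)) (cst (ap r n))).
      destruct (classic (exists f, ap D f = 1 /\ val f = b)) as [[f0 [Hf0 Hv]]|Hb].
      + destruct (H f0 Hf0) as [n0 Hn0]; exists (k + n0 + 1); intros f Hf Hfb.
        apply lt_succ in Hfb as [Hfb|Hfb].
        * destruct (Hk f Hf Hfb) as [n [Hn Hn']]; exists n; split; [|exact Hn'].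
          apply lt_succ, lt_le; eapply lt_le_trans; [exact Hn|apply le_add_r].
        * exists n0; split.
          -- apply lt_succ; rewrite add_comm; apply le_add_r.
          -- rewrite (d_val (e' := f0) (f' := ap x n0)); [exact Hn0|congruence|easy].
      + exists k; intros f Hf Hfb; apply lt_succ in Hfb as [Hfb|Hfb]; [auto|].
        destruct Hb; now exists f. }
  (* A ball covering the limit point covers all values from some [b] on; the values below [b] have
     just been treated. *)
  destruct (H pt pt_in) as [n0 Hn0]; destruct (near Hn0) as [b Hn].
  destruct (Hb b) as [k Hk]; exists (k + n0 + 1); intros f Hf.
  destruct (lt_or_le (val f) b) as [Hfb|Hfb].
  - destruct (Hk f Hf Hfb) as [n [Hn1 Hn2]]; exists n; split; [|exact Hn2].
    apply lt_succ, lt_le; eapply lt_le_trans; [exact Hn1|apply le_add_r].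
  - exists n0; split; [|now apply Hn].
    apply lt_succ; rewrite add_comm; apply le_add_r.
Qed.

Lemma totally_bounded_spec (l : car M ty1) (x : car M (N ⟶ N ⟶ ty1)%ty) :
  (forall n i, i < ap l n -> ap D (ap (ap x n) i) = 1) ->
  (forall f, ap D f = 1 -> forall n, exists i, i < ap l n
     /\ Rlt (ap (ap d f) (ap (ap x n) i)) (rpowR n)) ->
  forall n, (exists f, ap Y (seq_cons_m n f) = 0)
    <-> exists i, i < ap l (n + 1) /\ val (ap (ap x (n + 1)) i) = n + 1.
Proof.
  intros Hx Hd n; split.
  - intros [f Hf].
    assert (Hv : val (seq_cons_m (n + 1) f) = n + 1) by apply seq_cons_0.
    assert (Hf' : ap D (seq_cons_m (n + 1) f) = 1).
    { apply D_spec; right; exists n; now rewrite seq_cons_tl. }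
    destruct (Hd _ Hf' (n + 1)) as [i [Hi H]]; exists i; split; [exact Hi|].
    (* A net point of another value would be at distance 2^(-n-1) plus its own weight, which is not
       below 2^(-n-1). *)
    apply NNPP; intros K; rewrite d_spec, Hv, dist_neq in H by auto.
    apply Rlt_cst in H; [|apply mul_pos; apply pow2_pos|apply pow2_pos].
    apply (lt_not_le H); cbn; rewrite case_S.
    set (A := pow2 (n + 1)); set (v := val _).
    apply le_intro with (case 0 1 v * A * A); ring.
  (* Conversely, a net point of value n + 1 lies in the space, and its tail is a witness. *)
  - intros [i [Hi Hv]]; pose proof (Hx _ _ Hi) as H; apply D_spec in H.
    rewrite Hv in H; destruct H as [H|[n' [H H']]]; [now apply succ_neq_0 in H|].
    apply add_cancel in H; subst n'; eauto.
Qed.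

Lemma space_metric :
  sat (metric (Var (vs (vs vz))) (Var (vs vz)) (Var vz)) space_env.
Proof.
  split; [|split; [|split; [|split]]].
  - intros e f _ _; change (is_real_m (ap (ap d e) f)); rewrite d_spec.
    apply is_real_cst, dist_den.
  - intros e e' f f' _ _ _ _ H H'.
    change (ap (ap E e) e' = 1) in H; change (ap (ap E f) f' = 1) in H'.
    apply E_spec in H, H'; change (Req (ap (ap d e) f) (ap (ap d e') f')).
    rewrite (d_val H H'), d_spec; apply Req_cst, dist_den.
  - intros e f _ _.
    change ((Req (ap (ap d e) f) (cst (rcode rat0)) -> ap (ap E e) f = 1)
      /\ (ap (ap E e) f = 1 -> Req (ap (ap d e) f) (cst (rcode rat0)))).
    rewrite E_spec, d_spec; split; intros H.
    + apply NNPP; intros K.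
      (* Real equality at stage m allows an error of 2/2^m, hence the factor two; at a late stage a
         positive distance exceeds it. *)
      destruct (rlt_gap (p := rat0) (1 + 1) lt_0_1 (dist_den _ _) (dist_pos K)) as [m Hm].
      specialize (Hm m (le_refl m)); specialize (H m).
      rewrite !ap_cst, decodes_rcode, decodes_rcode in H by (apply lt_0_1 || apply dist_den).
      exact (lt_not_le Hm (proj1 H)).
    + rewrite H, dist_refl; apply Req_cst, lt_0_1.
  - intros e f _ _.
    change (Rle (cst (rcode rat0)) (ap (ap d e) f)
      /\ Req (ap (ap d e) f) (ap (ap d f) e)).
    rewrite !d_spec, (dist_sym (val f)); split; [|apply Req_cst, dist_den].
    intros n; rewrite !ap_cst, decodes_rcode, decodes_rcode
      by (apply lt_0_1 || apply dist_den).
    apply rle_0; cbn; rewrite dist_neg; ring.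
  - intros e f g _ _ _.
    change (Rle_add (ap (ap d f) e) (ap (ap d f) g) (ap (ap d g) e)); intros n.
    rewrite !d_spec, !ap_cst, !decodes_rcode by apply dist_den.
    apply dist_triangle.
Qed.

Lemma space_complete_metric_space :
  sat (complete_metric_space (Var (vs (vs vz))) (Var (vs vz)) (Var vz)) space_env.
Proof.
  split; [exact D_set|split; [exact E_rel|split; [|split; [exact space_metric|]]]].
  - split; [|split].
    + intros e _; now apply E_spec.
    + intros e f _ _ H; apply E_spec in H; apply E_spec; now symmetry.
    + intros e f g _ _ _ H H'; apply E_spec in H, H'; apply E_spec; congruence.
  - exact space_complete.
Qed.

(** The search in the net is an existential number quantifier over a quantifier-free matrix, with
    the net as parameter, so the set exists by comprehension for such formulas. *)
Lemma totally_bounded_BOOT :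
  sat (totally_bounded (Var (vs (vs vz))) (Var vz)) space_env ->
  exists X : car M ty1, (forall n, ap X n = 0 \/ ap X n = 1)
    /\ forall n, ap X n = 1 <-> exists f, ap Y (seq_cons_m n f) = 0.
Proof.
  intros (l & x & Hx & Hd).
  destruct (sigma1_comprehension
    (p := (Var vz < Var (vs (vs vz)) @ (Var (vs vz) + 1)
      /\ Var (vs (vs (vs vz))) @ (Var (vs vz) + 1) @ Var vz @ 0 = Var (vs vz) + 1)%form)
    (econs l (econs x (nil_env M))) (conj I I)) as [X HX].
  exists X; split; [apply HX|]; intros n.
  rewrite (totally_bounded_spec Hx Hd); apply HX.
Qed.

End Space.

(** The formula [p] stands for the compactness property, the only point in which the three items
    differ. *)
Lemma item_BOOT (p : form [(ty1 ⟶ ty1 ⟶ ty1)%ty; (ty1 ⟶ ty1 ⟶ N)%ty; ty2]) :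
  (forall Y D E d,
     (forall f, ap D f = 1 <-> val f = 0
        \/ exists n, val f = n + 1 /\ ap Y (seq_cons_m n (tl f)) = 0) ->
     (forall e f, ap (ap d e) f = cst (rcode (dist (val e) (val f)))) ->
     sat p (space_env D E d)) ->
  sat (All (All (All (Imp
      (complete_metric_space (Var (vs (vs vz))) (Var (vs vz)) (Var vz))
    (Imp p (totally_bounded (Var (vs (vs vz))) (Var vz))))))) (nil_env M) ->
  sat BOOT (nil_env M).
Proof.
  intros Hp H Y.
  destruct (space_points_exist Y) as [D HD], space_eq_exists as [E HE],
    space_dist_exists as [d Hd].
  destruct (totally_bounded_BOOT (Y := Y) (D := D) (E := E) (d := d)) as [X HX];
    [apply HD|exact Hd| |exact (ex_intro _ X HX)].
  apply H; [|apply (Hp Y); [apply HD|exact Hd]].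
  apply space_complete_metric_space with Y; apply HD || apply HE || exact Hd.
Qed.

End Model.

Lemma ACA0w_IND_completeness (p : form []) :
  (forall M, satisfies M ACA0w_IND -> sat p (nil_env M)) -> proves ACA0w_IND p.
Proof.
  apply completeness; [| |apply ACA0w_IND_sub_closed].
  - intros G q H; now apply ACA0w_IND_base, ACA0w_RCA0w, RCA0w_equality.
  - intros G r t; apply ACA0w_IND_base, ACA0w_RCA0w, RCA0w_ext.
Qed.

Theorem theorem3p13 :
  proves ACA0w_IND (Imp item_a BOOT) /\
  proves ACA0w_IND (Imp item_b BOOT) /\
  proves ACA0w_IND (Imp item_c BOOT).
Proof.
  split; [|split]; apply ACA0w_IND_completeness; intros M HM H;
    refine (item_BOOT HM _ H); intros Y D E d HD Hd.
  - intros R HR _.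
    exact (space_heine_borel HM HD Hd (R := R) (fun e He => proj2 (HR e He))).
  - intros x r _ _ H'; exact (space_countable_heine_borel HM HD Hd H').
  - intros x Hx; exact (space_sequentially_compact HM HD Hd Hx).
Qed.
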